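(* Let $G$ be an enriched group, $A$ a graded $G$-algebra, $M$ a $G$-coalgebra, and $n\in\mathbb{Z}$. Let $\{-,-\}_v$ be the $n$-graded biderivation in $A_M$ derived from an equivariant $n$-graded double bracket $\{\!\!\{-,-\}\!\!\}$ in $A$ and an equivariant cyclic bilinear form $v$ on $M$. Let $q:A_M\to A_M^G$ be the natural projection. If $G$ is finite, then there is a unique $n$-graded biderivation $\{-,-\}_v^G$ in $A_M^G$ such that for any $a,b\in A$, $\alpha,\beta\in M$, $$\{q(a_\alpha),q(b_\beta)\}_v^G=\sum_{g\in G}q\bigl(\{(ga)_{g\alpha},b_\beta\}_v\bigr).$$ If $\{\!\!\{-,-\}\!\!\}$ is a double Gerstenhaber bracket, then $\{-,-\}_v^G$ is a Gerstenhaber bracket.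
   Context: All modules, (co)algebras and tensor products are over a fixed commutative ring $\mathbb{K}$. Algebras are associative, not necessarily unital; coalgebras are coassociative, not necessarily counital, and not graded. Graded means $\mathbb{Z}$-graded, $|a|$ is the degree of a homogeneous element, $|a|_n=|a|+n$. Iterated comultiplication in $M$ is $\alpha\mapsto\alpha^1\otimes\cdots\otimes\alpha^m$ (summation suppressed). Elements of $A\otimes A$ are written $x=x'\otimes x''$ (summation suppressed, homogeneous factors). Enriched group: a group $G$ with a distinguished subgroup $G_0$ of index 1 or 2. Graded $G$-algebra: a graded algebra with a left action of $G$ where elements of $G_0$ act by graded algebra automorphisms and elements of $G\setminus G_0$ by graded algebra antiautomorphisms (grading-preserving linear isomorphisms $f$ with $f(ab)=(-1)^{|a||b|}f(b)f(a)$ for homogeneous $a,b$). $G$-coalgebra: a coalgebra with comultiplication $\mu$ and a left action of $G$ where elements of $G_0$ act by coalgebra automorphisms and elements of $G\setminus G_0$ by antiautomorphisms (linear isomorphisms $h$ with $(h\otimes h)\mu=p_{21}\mu h$, $p_{21}$ the flip). Biderivations: an $n$-graded biderivation in a graded algebra is a linear bracket of degree $n$ with $\{a,bc\}=\{a,b\}c+(-1)^{|a|_n|b|}b\{a,c\}$, $\{ab,c\}=a\{b,c\}+(-1)^{|b||c|_n}\{a,c\}b$, $\{a,b\}=-(-1)^{|a|_n|b|_n}\{b,a\}$ for homogeneous $a,b,c$. It is an ($n$-graded) Gerstenhaber bracket if $(-1)^{|a|_n|c|_n}\{a,\{b,c\}\}+(-1)^{|b|_n|a|_n}\{b,\{c,a\}\}+(-1)^{|c|_n|b|_n}\{c,\{a,b\}\}=0$.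 Double brackets: for a permutation $(i_1,\dots,i_m)$, $P_{i_1\cdots i_m,n}$ carries $a_1\otimes\cdots\otimes a_m$ to $(-1)^ta_{i_1}\otimes\cdots\otimes a_{i_m}$, $t$ being the sum of $|a_{i_k}|_n|a_{i_l}|_n$ over $k<l$ with $i_k>i_l$; $P_{i_1\cdots i_m}=P_{i_1\cdots i_m,0}$. Put $a(x\otimes y)b=ax\otimes yb$, $a*(x\otimes y)*b=(-1)^{|a||xb|+|b||y|}xb\otimes ay$. An $n$-graded double bracket in $A$ is a linear endomorphism $\{\!\!\{-,-\}\!\!\}$ of $A^{\otimes2}$ with $\{\!\!\{A^p,A^q\}\!\!\}\subset\bigoplus_{i+j=p+q+n}A^i\otimes A^j$, $\{\!\!\{-,-\}\!\!\}P_{21,n}=-P_{21}\{\!\!\{-,-\}\!\!\}$, $\{\!\!\{a,bc\}\!\!\}=\{\!\!\{a,b\}\!\!\}c+(-1)^{|a|_n|b|}b\{\!\!\{a,c\}\!\!\}$, $\{\!\!\{ab,c\}\!\!\}=a*\{\!\!\{b,c\}\!\!\}+(-1)^{|b||c|_n}\{\!\!\{a,c\}\!\!\}*b$. It is double Gerstenhaber if $\sum_{i=0}^2P_{312}^i(\{\!\!\{-,-\}\!\!\}\otimes\mathrm{id})(\mathrm{id}\otimes\{\!\!\{-,-\}\!\!\})P_{312,n}^{-i}=0$ on $A^{\otimes3}$. It is equivariant if for all $a,b\in A$: $\{\!\!\{ga,gb\}\!\!\}=(g\otimes g)\{\!\!\{a,b\}\!\!\}$ for $g\in G_0$ and $\{\!\!\{ga,gb\}\!\!\}=P_{21}(g\otimes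 g)\{\!\!\{a,b\}\!\!\}$ for $g\in G\setminus G_0$. Forms: $v:M\otimes M\to\mathbb{K}$ is cyclic if $\widehat v(\alpha\otimes\beta)=v(\alpha\otimes\beta^2)\beta^1\otimes\beta^3$ commutes with the flip of $M\otimes M$; equivariant if $v(g\alpha\otimes g\beta)=v(\alpha\otimes\beta)$ for all $g\in G$, $\alpha,\beta\in M$. Algebras: $A_M$ is the graded algebra generated by symbols $a_\alpha$ ($a\in A,\alpha\in M$), $|a_\alpha|=|a|$, subject to bilinearity in $(a,\alpha)$, $(ab)_\alpha=a_{\alpha^1}b_{\alpha^2}$, $a_\alpha b_\beta=(-1)^{|a||b|}b_\beta a_\alpha$. $A_M^G$ is the quotient of $A_M$ by the relations $(ga)_{g\alpha}=a_\alpha$ ($g\in G$, $a\in A$, $\alpha\in M$). Bracket: $\{-,-\}_v$ is the unique $n$-graded biderivation in $A_M$ with $\{a_\alpha,b_\beta\}_v=v(\alpha\otimes\beta^2)\{\!\!\{a,b\}\!\!\}'_{\beta^1}\{\!\!\{a,b\}\!\!\}''_{\beta^3}$ for all $a,b\in A$, $\alpha,\beta\in M$. *)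

(* Defs.v *)
From HB Require Import structures.
From mathcomp Require Import all_boot all_order all_algebra.
From mathcomp Require Import generic_quotient.
From mathcomp Require Import boolp classical_sets functions cardinality fsbigop.

Set Implicit Arguments.
Unset Strict Implicit.
Unset Printing Implicit Defensive.

Import GRing.Theory.
Local Open Scope classical_set_scope.
Local Open Scope ring_scope.
Local Open Scope quotient_scope.

(* Carriers with module operations that satisfy the module axioms only up to
   an equivalence relation.  Their quotients (qmod below) are the modules
   presented by generators and relations. *)
Record modSetoid (K : pzRingType) := ModSetoid {
  ms_car : Type;
  ms_eq : ms_car -> ms_car -> Prop;
  ms_zero : ms_car;
  ms_add : ms_car -> ms_car -> ms_car;
  ms_scale : K -> ms_car -> ms_car;
  ms_refl : forall x, ms_eq x x;
  ms_sym : forall x y, ms_eq x y -> ms_eq y x;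
  ms_trans : forall x y z, ms_eq x y -> ms_eq y z -> ms_eq x z;
  ms_congD : forall x x' y y', ms_eq x x' -> ms_eq y y' ->
    ms_eq (ms_add x y) (ms_add x' y');
  ms_congZ : forall k x x', ms_eq x x' -> ms_eq (ms_scale k x) (ms_scale k x');
  ms_addA : forall x y z,
    ms_eq (ms_add x (ms_add y z)) (ms_add (ms_add x y) z);
  ms_addC : forall x y, ms_eq (ms_add x y) (ms_add y x);
  ms_add0 : forall x, ms_eq (ms_add ms_zero x) x;
  ms_addN : forall x, ms_eq (ms_add (ms_scale (-1) x) x) ms_zero;
  ms_scaleA : forall k l x,
    ms_eq (ms_scale k (ms_scale l x)) (ms_scale (k * l) x);
  ms_scale1 : forall x, ms_eq (ms_scale 1 x) x;
  ms_scaleDr : forall k x y,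
    ms_eq (ms_scale k (ms_add x y)) (ms_add (ms_scale k x) (ms_scale k y));
  ms_scaleDl : forall k l x,
    ms_eq (ms_scale (k + l) x) (ms_add (ms_scale k x) (ms_scale l x)) }.

Section QuotientModule.
Variables (K : pzRingType) (S : modSetoid K).

Definition ms_rel (x y : {classic ms_car S}) : bool := `[< @ms_eq K S x y >].

Lemma ms_rel_refl : reflexive ms_rel.
Proof. by move=> x; apply/asboolP; apply: ms_refl. Qed.
Lemma ms_rel_sym : symmetric ms_rel.
Proof. by move=> x y; apply/asboolP/asboolP; apply: ms_sym. Qed.
Lemma ms_rel_trans : transitive ms_rel.
Proof.
by move=> y x z /asboolP h1 /asboolP h2; apply/asboolP; apply: ms_trans h1 h2.
Qed.

Definition ms_equiv := EquivRel ms_rel ms_rel_refl ms_rel_sym ms_rel_trans.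

Definition qmod : Type := {eq_quot ms_equiv}.
HB.instance Definition _ := Choice.on qmod.

Definition qpi (x : ms_car S) : qmod :=
  \pi_({eq_quot ms_equiv}) (x : {classic ms_car S}).
Definition qrepr (x : qmod) : ms_car S := repr (x : {eq_quot ms_equiv}).

Lemma qreprK x : qpi (qrepr x) = x.
Proof. exact: reprK. Qed.

Lemma qpiP x y : qpi x = qpi y <-> ms_eq x y.
Proof.
split=> [/eqP|h]; last by apply/eqP; rewrite eqmodE; apply/asboolP.
by rewrite eqmodE => /asboolP.
Qed.

Lemma qrepr_pi x : ms_eq (qrepr (qpi x)) x.
Proof. by apply/qpiP; rewrite qreprK. Qed.

Definition qzero : qmod := qpi (ms_zero S).
Definition qadd (x y : qmod) : qmod := qpi (ms_add (qrepr x) (qrepr y)).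
Definition qscale (k : K) (x : qmod) : qmod := qpi (ms_scale k (qrepr x)).
Definition qopp (x : qmod) : qmod := qscale (-1) x.

Lemma qaddE x y : qadd (qpi x) (qpi y) = qpi (ms_add x y).
Proof. by apply/qpiP/ms_congD; apply: qrepr_pi. Qed.
Lemma qscaleE k x : qscale k (qpi x) = qpi (ms_scale k x).
Proof. by apply/qpiP/ms_congZ; apply: qrepr_pi. Qed.

Lemma qaddA : associative qadd.
Proof.
move=> x y z; rewrite -(qreprK x) -(qreprK y) -(qreprK z) !qaddE.
by apply/qpiP/ms_addA.
Qed.
Lemma qaddC : commutative qadd.
Proof.
move=> x y; rewrite -(qreprK x) -(qreprK y) !qaddE.
by apply/qpiP/ms_addC.
Qed.
Lemma qadd0 : left_id qzero qadd.
Proof. by move=> x; rewrite -(qreprK x) qaddE; apply/qpiP/ms_add0. Qed.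
Lemma qaddN : left_inverse qzero qopp qadd.
Proof.
by move=> x; rewrite -(qreprK x) /qopp qscaleE qaddE; apply/qpiP/ms_addN.
Qed.

HB.instance Definition _ :=
  GRing.isZmodule.Build qmod qaddA qaddC qadd0 qaddN.

Lemma qscaleA k l x : qscale k (qscale l x) = qscale (k * l) x.
Proof. by rewrite -(qreprK x) !qscaleE; apply/qpiP/ms_scaleA. Qed.
Lemma qscale1 : left_id 1 qscale.
Proof. by move=> x; rewrite -(qreprK x) qscaleE; apply/qpiP/ms_scale1. Qed.
Lemma qscaleDr : right_distributive qscale +%R.
Proof.
move=> k x y; rewrite -(qreprK x) -(qreprK y) [_ + _]qaddE !qscaleE.
by rewrite [RHS]qaddE; apply/qpiP/ms_scaleDr.
Qed.
Lemma qscaleDl x : {morph qscale^~ x : k l / k + l}.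
Proof.
move=> k l; rewrite -(qreprK x) !qscaleE [RHS]qaddE.
by apply/qpiP/ms_scaleDl.
Qed.

HB.instance Definition _ := GRing.Zmodule_isLmodule.Build K qmod
  qscaleA qscale1 qscaleDr qscaleDl.

Lemma qpi0 : qpi (ms_zero S) = 0. Proof. by []. Qed.
Lemma qpiD x y : qpi (ms_add x y) = qpi x + qpi y.
Proof. by rewrite -qaddE. Qed.
Lemma qpiZ k x : qpi (ms_scale k x) = k *: qpi x.
Proof. by rewrite -qscaleE. Qed.

End QuotientModule.

Definition bilin (K : pzRingType) (U V W : lmodType K) (f : U -> V -> W) : Prop :=
  (forall v, linear (f^~ v)) /\ (forall u, linear (f u)).

Section Tensor.
Variables (K : comPzRingType) (U V : lmodType K).

Inductive tterm : Type :=
| TPure of U & V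
| TZero
| TAdd of tterm & tterm
| TScale of K & tterm.

Inductive tcong : tterm -> tterm -> Prop :=
| tcong_linl k u u' v :
    tcong (TPure (k *: u + u') v) (TAdd (TScale k (TPure u v)) (TPure u' v))
| tcong_linr k u v v' :
    tcong (TPure u (k *: v + v')) (TAdd (TScale k (TPure u v)) (TPure u v'))
| tcong_refl s : tcong s s
| tcong_sym s t : tcong s t -> tcong t s
| tcong_trans s t r : tcong s t -> tcong t r -> tcong s r
| tcong_congD s s' t t' : tcong s s' -> tcong t t' -> tcong (TAdd s t) (TAdd s' t')
| tcong_congZ k s s' : tcong s s' -> tcong (TScale k s) (TScale k s')
| tcong_addA s t r : tcong (TAdd s (TAdd t r)) (TAdd (TAdd s t) r)
| tcong_addC s t : tcong (TAdd s t) (TAdd t s)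
| tcong_add0 s : tcong (TAdd TZero s) s
| tcong_addN s : tcong (TAdd (TScale (-1) s) s) TZero
| tcong_scaleA k l s : tcong (TScale k (TScale l s)) (TScale (k * l) s)
| tcong_scale1 s : tcong (TScale 1 s) s
| tcong_scaleDr k s t :
    tcong (TScale k (TAdd s t)) (TAdd (TScale k s) (TScale k t))
| tcong_scaleDl k l s :
    tcong (TScale (k + l) s) (TAdd (TScale k s) (TScale l s)).

Definition tens_setoid : modSetoid K :=
  ModSetoid tcong_refl tcong_sym tcong_trans tcong_congD tcong_congZ
    tcong_addA tcong_addC tcong_add0 tcong_addN tcong_scaleA tcong_scale1
    tcong_scaleDr tcong_scaleDl.

Definition tens : lmodType K := qmod tens_setoid.

Definition tpure (u : U) (v : V) : tens := qpi (S := tens_setoid) (TPure u v).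

Lemma tpure_bilin : bilin tpure.
Proof.
split=> [v k u u'|u k v v'].
  transitivity (qpi (S := tens_setoid)
    (TAdd (TScale k (TPure u v)) (TPure u' v))).
    by apply/qpiP; apply: tcong_linl.
  by rewrite qpiD qpiZ.
transitivity (qpi (S := tens_setoid)
  (TAdd (TScale k (TPure u v)) (TPure u v'))).
  by apply/qpiP; apply: tcong_linr.
by rewrite qpiD qpiZ.
Qed.

Lemma tens_ind (P : tens -> Prop) :
  P 0 -> (forall u v, P (tpure u v)) -> (forall x y, P x -> P y -> P (x + y)) ->
  (forall k x, P x -> P (k *: x)) -> forall x, P x.
Proof.
move=> P0 Pp PD PZ x; rewrite -(qreprK x); elim: (qrepr x) => [u v||s IHs t IHt|k s IHs].
- exact: Pp.
- exact: P0.
- by rewrite qpiD; apply: PD.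
- by rewrite qpiZ; apply: PZ.
Qed.

Section Lift.
Variables (W : lmodType K) (f : U -> V -> W).

Fixpoint teval (s : tterm) : W :=
  match s with
  | TPure u v => f u v
  | TZero => 0
  | TAdd s t => teval s + teval t
  | TScale k s => k *: teval s
  end.

(* The linear map U (x) V -> W induced by f; only meaningful if f is bilinear. *)
Definition tlift (x : tens) : W := teval (qrepr x).

Hypothesis f_bilin : bilin f.

Lemma teval_cong s t : tcong s t -> teval s = teval t.
Proof.
case: f_bilin => fl fr.
elim=> //= [k u u' v|k u v v'|s0 t0 r _ -> _ //|s0 s' t0 t' _ -> _ ->//|
  k s0 s' _ ->//|s0 t0 r|s0 t0|s0|s0|k l s0|s0|k s0 t0|k l s0].
- exact: fl.
- exact: fr.
- by rewrite addrA.
- by rewrite addrC.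
- by rewrite add0r.
- by rewrite scaleN1r addNr.
- by rewrite scalerA.
- by rewrite scale1r.
- by rewrite scalerDr.
- by rewrite scalerDl.
Qed.

Lemma tlift_pi s : tlift (qpi (S := tens_setoid) s) = teval s.
Proof. exact: teval_cong (qrepr_pi (S := tens_setoid) s). Qed.

Lemma tlift_pure u v : tlift (tpure u v) = f u v.
Proof. exact: tlift_pi. Qed.

Lemma tlift_linear : linear tlift.
Proof.
move=> k x y; rewrite -(qreprK x) -(qreprK y) -qpiZ -qpiD.
by rewrite !tlift_pi.
Qed.

Lemma tlift_uniq (g : {linear tens -> W}) :
  (forall u v, g (tpure u v) = f u v) -> g =1 tlift.
Proof.
move=> gE x; pose h := GRing.isLinear.Build _ _ _ _ tlift tlift_linear.
pose l : {linear tens -> W} := HB.pack tlift h.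
change (g x = l x); elim/tens_ind: x => [|u v|x y IHx IHy|k x IHx].
- by rewrite !linear0.
- by rewrite gE /l /= tlift_pure.
- by rewrite !linearD IHx IHy.
- by rewrite !linearZ_LR IHx.
Qed.

End Lift.
End Tensor.

Arguments tlift {K U V W} f x.
Notation "u \ox v" := (tpure u v) (at level 38, left associativity) : ring_scope.

Section TensorMaps.
Variable K : comPzRingType.
Implicit Types U V W : lmodType K.

Definition tmap U V U' V' (f : U -> U') (g : V -> V') : tens U V -> tens U' V' :=
  tlift (fun u v => f u \ox g v).

Definition tflip U V : tens U V -> tens V U := tlift (fun u v => v \ox u).

Definition tassoc U V W : tens (tens U V) W -> tens U (tens V W) :=
  tlift (fun uv w => tlift (fun u v => u \ox (v \ox w)) uv).

Definition tassoc_inv U V W : tens U (tens V W) -> tens (tens U V) W :=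
  tlift (fun u vw => tlift (fun v w => (u \ox v) \ox w) vw).

End TensorMaps.

Definition submodule (K : pzRingType) (V : lmodType K) (H : set V) : Prop :=
  H 0 /\ forall k x y, H x -> H y -> H (k *: x + y).

(* V is the internal direct sum of the submodules H p. *)
Definition direct_sum (K : pzRingType) (V : lmodType K) (H : int -> set V) : Prop :=
  (forall p, submodule (H p)) /\
  forall x, exists! f : int -> V,
    [/\ forall p, H p (f p), finite_set [set p | f p != 0]
      & x = \sum_(p \in [set: int]) f p].

Record gradedAlg (K : comPzRingType) := GradedAlg {
  ga_mod :> lmodType K;
  ga_mul : ga_mod -> ga_mod -> ga_mod;
  ga_hom : int -> set ga_mod;
  ga_mul_bilin : bilin ga_mul;
  ga_mulA : associative ga_mul;
  ga_direct : direct_sum ga_hom;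
  ga_hom_mul : forall p q a b,
    ga_hom p a -> ga_hom q b -> ga_hom (p + q) (ga_mul a b) }.

Arguments ga_hom {K A} p a : rename.
Notation "a \m b" := (ga_mul a b) (at level 40, left associativity) : ring_scope.

Definition sgnz (K : pzRingType) (k : int) : K := (-1) ^+ `|k|%N.
Arguments sgnz {K} k.

Section GradedComponents.
Variables (K : comPzRingType) (A : gradedAlg K).

Definition gcomp (a : A) : int -> A := projT1 (cid (proj2 (ga_direct A) a)).

Lemma compP a : [/\ forall p, ga_hom p (gcomp a p),
  finite_set [set p | gcomp a p != 0] & a = \sum_(p \in [set: int]) gcomp a p].
Proof. by rewrite /gcomp; case: cid => f []. Qed.

Lemma comp_uniq a f : (forall p, ga_hom p (f p)) ->
  finite_set [set p | f p != 0] -> a = \sum_(p \in [set: int]) f p ->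
  gcomp a = f.
Proof. by rewrite /gcomp; case: cid => g /= [_ gu] h1 h2 h3; apply: gu. Qed.

(* The extension to all of A of a rule f p given on elements of degree p. *)
Definition hsum (W : lmodType K) (f : int -> A -> W) (a : A) : W :=
  \sum_(p \in [set: int]) f p (gcomp a p).

End GradedComponents.

Lemma fsum_seq (V : zmodType) (f : int -> V) (s : seq int) : uniq s ->
  (forall p, f p != 0 -> p \in s) ->
  \sum_(p \in [set: int]) f p = \sum_(p <- s) f p.
Proof.
move=> us hs; rewrite [RHS]fsbig_seq //; apply/esym/fsbig_widen => // p [_ /= ps].
by apply: contra_notP ps => /eqP/hs.
Qed.

Lemma finite_supp_seq (V : zmodType) (f : int -> V) :
  finite_set [set p | f p != 0] -> exists s, uniq s /\ forall p, f p != 0 -> p \in s.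
Proof.
move=> /finite_seqP[s sE]; exists (undup s); split; first exact: undup_uniq.
by move=> p hp; rewrite mem_undup; have : [set` s] p by rewrite -sE.
Qed.

Lemma direct_sum_proj (K : pzRingType) (V : lmodType K) (H : int -> set V)
    (P : int -> V -> V) :
  (forall p, submodule (H p)) ->
  (forall p, linear (P p)) ->
  (forall p x, H p (P p x)) ->
  (forall p q x, H q x -> P p x = if p == q then x else 0) ->
  (forall x, exists s : seq (int * V),
    (forall e, e \in s -> H e.1 e.2) /\ x = \sum_(e <- s) e.2) ->
  direct_sum H.
Proof.
move=> Hs Pl HP PH Hx; split=> // x.
have P0 p : P p 0 = 0 by rewrite (PH p p) ?eqxx //; case: (Hs p).
have PD p y z : P p (y + z) = P p y + P p z by rewrite -{1}[y]scale1r Pl scale1r.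
have Psum p (I : Type) (r : seq I) (F : I -> V) :
    P p (\sum_(i <- r) F i) = \sum_(i <- r) P p (F i).
  by elim: r => [|i r IHr]; rewrite ?big_nil ?P0 // !big_cons PD IHr.
case: (Hx x) => s [sH xE].
have PE p : P p x = \sum_(e <- s | e.1 == p) e.2.
  rewrite xE Psum [in RHS]big_mkcond /= !big_seq; apply: eq_bigr => e es.
  by rewrite (PH _ _ _ (sH _ es)) eq_sym.
have sup p : P p x != 0 -> p \in undup (map fst s).
  rewrite mem_undup; apply: contraR => ps; rewrite PE big_seq_cond big1 // => e.
  case/andP=> es /eqP ep; case/negP: ps; rewrite -ep.
  exact: map_f.
exists (fun p => P p x); split.
  split=> //.
    apply: (@sub_finite_set _ _ [set` undup (map fst s)]); first exact: sup.
    exact: finite_seq.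
  rewrite (fsum_seq (undup_uniq (map fst s))) //.
  under eq_bigr => p _ do rewrite PE.
  rewrite (exchange_big_dep xpredT) //= {1}xE big_seq [RHS]big_seq.
  apply: eq_bigr => e es.
  rewrite (eq_bigl (pred1 e.1)) => [|p]; last by rewrite /= eq_sym.
  rewrite big_const_seq.
  rewrite count_uniq_mem ?undup_uniq // mem_undup map_f //=.
  by rewrite addr0.
move=> g [gH /finite_supp_seq[r [ur hr]] gx]; apply/funext => p.
rewrite gx (fsum_seq ur hr) Psum.
rewrite (eq_bigr (fun i => if i == p then g i else 0)); last first.
  by move=> i _; rewrite (PH _ i) // eq_sym.
rewrite -big_mkcond /=; case: (boolP (p \in r)) => [pr|npr].
  by rewrite -big_filter filter_pred1_uniq // big_seq1.
rewrite big_seq_cond big1; last first.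
  by move=> i /andP[ir /eqP ip]; rewrite -ip ir in npr.
by apply/esym/eqP; apply: contraR npr => /hr.
Qed.

Section GradedComponentsTheory.
Variables (K : comPzRingType) (A : gradedAlg K).
Implicit Types (a b : A) (p q : int).

Lemma hom0 p : ga_hom p (0 : A).
Proof. by case: (ga_direct A) => /(_ p)[]. Qed.
Lemma homZD p k a b : ga_hom p a -> ga_hom p b -> ga_hom p (k *: a + b).
Proof. by case: (ga_direct A) => /(_ p)[_ h] _; apply: h. Qed.
Lemma homD p a b : ga_hom p a -> ga_hom p b -> ga_hom p (a + b).
Proof. by move=> ha hb; rewrite -[a]scale1r; apply: homZD. Qed.
Lemma homZ p k a : ga_hom p a -> ga_hom p (k *: a).
Proof. by move=> ha; rewrite -[_ *: _]addr0; apply: homZD => //; apply: hom0. Qed.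

Lemma comp_hom a p : ga_hom p (gcomp a p).
Proof. by case: (compP a). Qed.

Lemma comp_seq a : exists s : seq int,
  [/\ uniq s, forall p, gcomp a p != 0 -> p \in s & a = \sum_(p <- s) gcomp a p].
Proof.
case: (compP a) => _ /finite_supp_seq[s [us hs]] aE.
by exists s; split=> //; rewrite {1}aE (fsum_seq us).
Qed.

Lemma compE p a : ga_hom p a -> gcomp a = (fun q => if q == p then a else 0).
Proof.
move=> ha.
have sup q : (if q == p then a else 0) != 0 -> q \in [:: p].
  by rewrite inE; case: (eqVneq q p) => // _; rewrite eqxx.
apply: comp_uniq => [q||].
- by case: eqP => [->//|_]; apply: hom0.
- apply: (@sub_finite_set _ _ [set` [:: p]]); first exact: sup.
  exact: finite_seq.
- by rewrite (@fsum_seq _ _ [:: p]) // big_seq1 eqxx.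
Qed.

Lemma comp_linear p : linear (fun a => gcomp a p).
Proof.
move=> k a b.
case: (comp_seq a) => s [_ sa aE]; case: (comp_seq b) => t [_ tb bE].
pose r := undup (s ++ t).
have ar q : gcomp a q != 0 -> q \in r.
  by move=> /sa h; rewrite mem_undup mem_cat h.
have br q : gcomp b q != 0 -> q \in r.
  by move=> /tb h; rewrite mem_undup mem_cat h orbT.
have sup q : k *: gcomp a q + gcomp b q != 0 -> q \in r.
  apply: contraR => qr.
  have /eqP-> : gcomp a q == 0 by apply: contraR qr => /ar.
  have /eqP-> : gcomp b q == 0 by apply: contraR qr => /br.
  by rewrite scaler0 addr0.
rewrite (@comp_uniq _ _ _ (fun p => k *: gcomp a p + gcomp b p)) //.
- by move=> q; apply: homZD; apply: comp_hom.
- apply: (@sub_finite_set _ _ [set` r]); first exact: sup.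
  exact: finite_seq.
- rewrite (fsum_seq _ sup) ?undup_uniq // big_split -scaler_sumr /=.
  congr (_ *: _ + _).
    case: (compP a) => _ _ {1}->; apply: fsum_seq; rewrite ?undup_uniq //.
  case: (compP b) => _ _ {1}->; apply: fsum_seq; rewrite ?undup_uniq //.
Qed.

Lemma hsum_hom (W : lmodType K) (f : int -> A -> W) p a :
  (forall q, f q 0 = 0) -> ga_hom p a -> hsum f a = f p a.
Proof.
move=> f0 ha; rewrite /hsum (@fsum_seq _ _ [:: p]) //.
  by rewrite big_seq1 (compE ha) eqxx.
by move=> q; rewrite (compE ha) inE; case: (eqVneq q p) => // _; rewrite f0 eqxx.
Qed.

Lemma hsum_seq (W : lmodType K) (f : int -> A -> W) a : 
  (forall q, f q 0 = 0) -> exists s, uniq s /\ forall r, uniq r ->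
   {subset s <= r} -> hsum f a = \sum_(p <- r) f p (gcomp a p).
Proof.
move=> f0; case: (comp_seq a) => s [us hs _]; exists s; split=> // r ur sr.
apply: fsum_seq => // p; apply: contraR => pr.
have /eqP-> : gcomp a p == 0 by apply: contraR pr => /hs/sr.
by rewrite f0.
Qed.

Lemma hsum_linear (W : lmodType K) (f : int -> A -> W) :
  (forall p, linear (f p)) -> linear (hsum f).
Proof.
move=> fl k a b.
have f0 q : f q 0 = 0.
  by have := fl q (-1) 0 0; rewrite scaler0 addr0 scaleN1r addNr.
have [s [_ sE]] := hsum_seq a f0; have [t [_ tE]] := hsum_seq b f0.
have [r [_ rE]] := hsum_seq (k *: a + b) f0.
pose w := undup (s ++ t ++ r).
have uw : uniq w by apply: undup_uniq.
rewrite (sE w) ?(tE w) ?(rE w) //; last first.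
- by move=> i h; rewrite mem_undup !mem_cat h.
- by move=> i h; rewrite mem_undup !mem_cat h ?orbT.
- by move=> i h; rewrite mem_undup !mem_cat h ?orbT.
by rewrite scaler_sumr -big_split; apply: eq_bigr => i _ /=; rewrite comp_linear fl.
Qed.

End GradedComponentsTheory.

Section PermutationMaps.
Variables (K : comPzRingType) (A : gradedAlg K) (W : lmodType K).

Definition hsum2 (f : int -> int -> A -> A -> W) (a b : A) : W :=
  hsum (fun p a => hsum (fun q b => f p q a b) b) a.

Definition hsum3 (f : int -> int -> int -> A -> A -> A -> W) (a b c : A) : W :=
  hsum (fun p a => hsum2 (fun q r b c => f p q r a b c) b c) a.

End PermutationMaps.

Definition tlift3 (K : comPzRingType) (U V X W : lmodType K)
    (f : U -> V -> X -> W) : tens U (tens V X) -> W :=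
  tlift (fun (u : U) (vx : tens V X) => tlift (fun v x => f u v x) vx).

(* On homogeneous elements see P21E, P312E and P231E below. *)
Definition P21 (K : comPzRingType) (A : gradedAlg K) (n : int) :
    tens A A -> tens A A :=
  tlift (hsum2 (fun p q (a b : A) => sgnz ((p + n) * (q + n)) *: (b \ox a))).

Definition P312 (K : comPzRingType) (A : gradedAlg K) (n : int) :
    tens A (tens A A) -> tens A (tens A A) :=
  tlift3 (hsum3 (fun p q r (a b c : A) =>
    sgnz ((p + n) * (r + n) + (q + n) * (r + n)) *: (c \ox (a \ox b)))).

(* The inverse of P312 n, see P312K and P231K. *)
Definition P231 (K : comPzRingType) (A : gradedAlg K) (n : int) :
    tens A (tens A A) -> tens A (tens A A) :=
  tlift3 (hsum3 (fun p q r (a b c : A) =>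
    sgnz ((p + n) * (q + n) + (p + n) * (r + n)) *: (b \ox (c \ox a)))).

Section PermutationTheory.
Variables (K : comPzRingType).
Implicit Types U V W : lmodType K.

Lemma sgnzM (k : int) : sgnz k * sgnz k = 1 :> K.
Proof. by rewrite /sgnz -exprMn mulrNN mulr1 expr1n. Qed.

Lemma linear_fun0 U W (f : U -> W) : linear f -> f 0 = 0.
Proof. by move=> fl; have := fl (-1) 0 0; rewrite scaler0 addr0 scaleN1r addNr. Qed.
Lemma linear_funD U W (f : U -> W) x y : linear f -> f (x + y) = f x + f y.
Proof. by move=> fl; rewrite -{1}[x]scale1r fl scale1r. Qed.
Lemma linear_funZ U W (f : U -> W) k x : linear f -> f (k *: x) = k *: f x.
Proof. by move=> fl; rewrite -{1}[_ *: x]addr0 fl (linear_fun0 fl) addr0. Qed.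
Lemma linear_fun_sum U W (f : U -> W) I (r : seq I) (P : pred I) (F : I -> U) :
  linear f -> f (\sum_(i <- r | P i) F i) = \sum_(i <- r | P i) f (F i).
Proof.
move=> fl; elim: r => [|i r IHr]; first by rewrite !big_nil linear_fun0.
by rewrite !big_cons; case: (P i); rewrite ?linear_funD // IHr.
Qed.

Lemma tpurel U V (v : V) : linear (fun u : U => u \ox v).
Proof. by case: (tpure_bilin U V). Qed.
Lemma tpurer U V (u : U) : linear (fun v : V => u \ox v).
Proof. by case: (tpure_bilin U V). Qed.
Lemma tpure0l U V (v : V) : (0 : U) \ox v = 0.
Proof. exact: linear_fun0 (tpurel v). Qed.
Lemma tpure0r U V (u : U) : u \ox (0 : V) = 0.
Proof. exact: linear_fun0 (tpurer u). Qed.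

Lemma linear_scale_fun U W (k : K) (f : U -> W) :
  linear f -> linear (fun x => k *: f x).
Proof. by move=> fl l x y; rewrite fl scalerDr !scalerA mulrC. Qed.

Lemma tlift_linear_param U V W X (f : X -> U -> V -> W) (x : tens U V) (k : K)
    (a b c : X) :
  (forall u v, f c u v = k *: f a u v + f b u v) ->
  tlift (f c) x = k *: tlift (f a) x + tlift (f b) x.
Proof.
move=> fE; rewrite /tlift.
elim: (qrepr x) => [u v||s IHs t IHt|l s IHs] /=.
- exact: fE.
- by rewrite scaler0 addr0.
- by rewrite IHs IHt scalerDr addrACA.
- by rewrite IHs scalerDr !scalerA mulrC.
Qed.

Section Trilinear.
Variables (U V X W : lmodType K).

Definition trilin (f : U -> V -> X -> W) :=
  (forall u, bilin (f u)) /\ (forall v x, linear (fun u => f u v x)).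

Lemma tlift3_bilin (f : U -> V -> X -> W) : trilin f ->
  bilin (fun (a : U) (bc : tens V X) => tlift (fun b c => f a b c) bc).
Proof.
case=> fb fl; split=> [x k a b|a]; last by apply: tlift_linear.
by apply: tlift_linear_param => u v; apply: fl.
Qed.

Lemma tlift3_pure (f : U -> V -> X -> W) a b c : trilin f ->
  tlift3 f (a \ox (b \ox c)) = f a b c.
Proof.
move=> ft; rewrite /tlift3 tlift_pure; last exact: tlift3_bilin.
by rewrite tlift_pure //; case: ft.
Qed.

Lemma tlift3_linear (f : U -> V -> X -> W) : trilin f -> linear (tlift3 f).
Proof. by move=> ft; apply/tlift_linear/tlift3_bilin. Qed.

End Trilinear.

Variables (A : gradedAlg K) (W : lmodType K).

Lemma hsum_linear_param (U : lmodType K) (f : int -> U -> A -> W) (a : A) :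
  (forall p a, linear (fun u => f p u a)) -> (forall p u, linear (f p u)) ->
  linear (fun u => hsum (fun p => f p u) a).
Proof.
move=> fl fr k u v.
have f0 w q : f q w 0 = 0 by apply: linear_fun0.
have [s [us sE]] := hsum_seq (f := fun p => f p u) a (f0 u).
have [t [ut tE]] := hsum_seq (f := fun p => f p v) a (f0 v).
have [r [ur rE]] := hsum_seq (f := fun p => f p (k *: u + v)) a (f0 (k *: u + v)).
pose w := undup (s ++ t ++ r).
have uw : uniq w by apply: undup_uniq.
rewrite (sE w) ?(tE w) ?(rE w) //; last first.
- by move=> i h; rewrite mem_undup !mem_cat h.
- by move=> i h; rewrite mem_undup !mem_cat h ?orbT.
- by move=> i h; rewrite mem_undup !mem_cat h ?orbT.
by rewrite scaler_sumr -big_split; apply: eq_bigr => i _ /=; rewrite fl.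
Qed.

Lemma hsum0 (f : int -> A -> W) a : (forall p x, f p x = 0) -> hsum f a = 0.
Proof. by move=> f0; rewrite /hsum fsbig1. Qed.

Lemma hsum2_bilin (f : int -> int -> A -> A -> W) :
  (forall p q, bilin (f p q)) -> bilin (hsum2 f).
Proof.
move=> fb; split=> [b|a].
  apply: hsum_linear => p.
  apply: (hsum_linear_param (f := fun q => f p q)) => q; first by case: (fb p q).
  by case: (fb p q).
apply: (hsum_linear_param (f := fun p b a => hsum (fun q => f p q a) b)) => p c.
  by apply: hsum_linear => q; case: (fb p q).
by apply: (hsum_linear_param (f := fun q => f p q)) => q; case: (fb p q).
Qed.

Lemma hsum2_hom (f : int -> int -> A -> A -> W) p q a b :
  (forall p q, bilin (f p q)) -> ga_hom p a -> ga_hom q b ->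
  hsum2 f a b = f p q a b.
Proof.
move=> fb ha hb; rewrite /hsum2 (hsum_hom _ ha) => [|i].
  by rewrite (hsum_hom _ hb) // => i; apply: linear_fun0; case: (fb p i).
by apply: hsum0 => j x; apply: (@linear_fun0 _ _ ((f i j)^~ x)); case: (fb i j).
Qed.

Lemma hsum3_trilin (f : int -> int -> int -> A -> A -> A -> W) :
  (forall p q r, trilin (f p q r)) -> trilin (hsum3 f).
Proof.
move=> ft; have b2 p a : bilin (hsum2 (fun q r => f p q r a)).
  by apply: hsum2_bilin => q r; case: (ft p q r).
have l2 p b c : linear (fun a => hsum2 (fun q r => f p q r a) b c).
  apply: (hsum_linear_param (f := fun q a b => hsum (fun r => f p q r a b) c)) => q x.
    apply: (hsum_linear_param (f := fun r a => f p q r a x)) => r y.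
      by case: (ft p q r).
    by case: (ft p q r) => /(_ y)[].
  apply: (hsum_linear_param (f := fun r b => f p q r x b)) => r y.
    by case: (ft p q r) => /(_ x)[].
  by case: (ft p q r) => /(_ x)[].
split=> [a|b c]; last by apply: hsum_linear.
split=> [c|b].
  apply: (hsum_linear_param
    (f := fun p b a => hsum2 (fun q r => f p q r a) b c)) => p x //.
  by case: (b2 p x).
apply: (hsum_linear_param
  (f := fun p c a => hsum2 (fun q r => f p q r a) b c)) => p x //.
by case: (b2 p x).
Qed.

Lemma hsum3_hom (f : int -> int -> int -> A -> A -> A -> W) p q r a b c :
  (forall p q r, trilin (f p q r)) -> ga_hom p a -> ga_hom q b -> ga_hom r c ->
  hsum3 f a b c = f p q r a b c.
Proof.
move=> ft ha hb hc; rewrite /hsum3 (hsum_hom _ ha) => [|i].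
  by rewrite (hsum2_hom _ hb hc) // => i j; case: (ft p i j).
apply: hsum0 => j x; apply: hsum0 => k y.
by apply: (@linear_fun0 _ _ (fun a => f i j k a x y)); case: (ft i j k).
Qed.

End PermutationTheory.

Section PermutationMapsTheory.
Variables (K : comPzRingType) (A : gradedAlg K) (n : int).
Implicit Types (p q r : int) (a b c : A).

Lemma tens_eq (U V W : lmodType K) (f g : tens U V -> W) : linear f -> linear g ->
  (forall u v, f (u \ox v) = g (u \ox v)) -> f =1 g.
Proof.
move=> fl gl fg; elim/tens_ind => [|u v|x y IHx IHy|k x IHx] //.
- by rewrite !linear_fun0.
- by rewrite !linear_funD // IHx IHy.
- by rewrite !linear_funZ // IHx.
Qed.

Lemma linear_id_fun (U : lmodType K) : linear (fun x : U => x).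
Proof. by []. Qed.

Lemma P21_bilin p q :
  bilin (fun a b => sgnz ((p + n) * (q + n)) *: (b \ox a) : tens A A).
Proof.
split=> [b|a]; apply: linear_scale_fun; [exact: tpurer|exact: tpurel].
Qed.

Lemma P21E p q a b : ga_hom p a -> ga_hom q b ->
  P21 n (a \ox b) = sgnz ((p + n) * (q + n)) *: (b \ox a).
Proof.
move=> ha hb; rewrite /P21 tlift_pure.
  by rewrite (hsum2_hom P21_bilin ha hb).
exact/hsum2_bilin/P21_bilin.
Qed.

Lemma P21_linear : linear (P21 (A := A) n).
Proof. exact/tlift_linear/hsum2_bilin/P21_bilin. Qed.

Lemma P312_trilin p q r : trilin (fun a b c =>
  sgnz ((p + n) * (r + n) + (q + n) * (r + n)) *: (c \ox (a \ox b))
    : tens A (tens A A)).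
Proof.
split=> [a|b c]; last first.
  by apply: linear_scale_fun => k x y; rewrite tpurel tpurer.
split=> [c|b]; apply: linear_scale_fun => k x y; last by rewrite tpurel.
by rewrite !tpurer.
Qed.

Lemma P312E p q r a b c : ga_hom p a -> ga_hom q b -> ga_hom r c ->
  P312 n (a \ox (b \ox c)) =
  sgnz ((p + n) * (r + n) + (q + n) * (r + n)) *: (c \ox (a \ox b)).
Proof.
move=> ha hb hc; rewrite /P312 tlift3_pure.
  by rewrite (hsum3_hom P312_trilin ha hb hc).
exact/hsum3_trilin/P312_trilin.
Qed.

Lemma P312_linear : linear (P312 (A := A) n).
Proof. exact/tlift3_linear/hsum3_trilin/P312_trilin. Qed.

Lemma P231_trilin p q r : trilin (fun a b c =>
  sgnz ((p + n) * (q + n) + (p + n) * (r + n)) *: (b \ox (c \ox a))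
    : tens A (tens A A)).
Proof.
split=> [a|b c]; last first.
  by apply: linear_scale_fun => k x y; rewrite !tpurer.
split=> [c|b]; apply: linear_scale_fun => k x y; first by rewrite tpurel.
by rewrite tpurel tpurer.
Qed.

Lemma P231E p q r a b c : ga_hom p a -> ga_hom q b -> ga_hom r c ->
  P231 n (a \ox (b \ox c)) =
  sgnz ((p + n) * (q + n) + (p + n) * (r + n)) *: (b \ox (c \ox a)).
Proof.
move=> ha hb hc; rewrite /P231 tlift3_pure.
  by rewrite (hsum3_hom P231_trilin ha hb hc).
exact/hsum3_trilin/P231_trilin.
Qed.

Lemma P231_linear : linear (P231 (A := A) n).
Proof. exact/tlift3_linear/hsum3_trilin/P231_trilin. Qed.

Lemma tens3_hom_ind (P : tens A (tens A A) -> Prop) :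
  P 0 -> (forall x y, P x -> P y -> P (x + y)) ->
  (forall k x, P x -> P (k *: x)) ->
  (forall p q r a b c, ga_hom p a -> ga_hom q b -> ga_hom r c ->
     P (a \ox (b \ox c))) -> forall x, P x.
Proof.
move=> P0 PD PZ Ph.
have Ps I (s : seq I) (F : I -> tens A (tens A A)) :
    (forall i, P (F i)) -> P (\sum_(i <- s) F i).
  by move=> h; elim/big_rec: _ => // i x _; apply: PD.
apply: tens_ind => // a; apply: tens_ind => [|b c|x y IHx IHy|k x IHx].
- by rewrite tpure0r.
- case: (comp_seq a) => s [_ _ ->]; case: (comp_seq b) => t [_ _ ->].
  case: (comp_seq c) => r [_ _ ->].
  rewrite (linear_fun_sum _ _ _ (tpurel _)); apply: (Ps _) => i.
  rewrite (linear_fun_sum _ _ _ (tpurel _)).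
  rewrite (linear_fun_sum _ _ _ (tpurer _)); apply: (Ps _) => j.
  rewrite (linear_fun_sum _ _ _ (tpurer _)).
  rewrite (linear_fun_sum _ _ _ (tpurer _)); apply: (Ps _) => k.
  by apply: Ph; apply: comp_hom.
- by rewrite (linear_funD _ _ (tpurer a)); apply: PD.
- by rewrite (linear_funZ _ _ (tpurer a)); apply: PZ.
Qed.

Lemma P231K : cancel (P231 (A := A) n) (P312 n).
Proof.
apply: tens3_hom_ind => [|x y IHx IHy|k x IHx|p q r a b c ha hb hc].
- by rewrite (linear_fun0 P231_linear) (linear_fun0 P312_linear).
- by rewrite (linear_funD _ _ P231_linear) (linear_funD _ _ P312_linear) IHx IHy.
- by rewrite (linear_funZ _ _ P231_linear) (linear_funZ _ _ P312_linear) IHx.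
rewrite (P231E ha hb hc) (linear_funZ _ _ P312_linear) (P312E hb hc ha) scalerA.
by rewrite [(q + n) * (p + n)]mulrC [(r + n) * (p + n)]mulrC sgnzM scale1r.
Qed.

Lemma P312K : cancel (P312 (A := A) n) (P231 n).
Proof.
apply: tens3_hom_ind => [|x y IHx IHy|k x IHx|p q r a b c ha hb hc].
- by rewrite (linear_fun0 P312_linear) (linear_fun0 P231_linear).
- by rewrite (linear_funD _ _ P312_linear) (linear_funD _ _ P231_linear) IHx IHy.
- by rewrite (linear_funZ _ _ P312_linear) (linear_funZ _ _ P231_linear) IHx.
rewrite (P312E ha hb hc) (linear_funZ _ _ P231_linear) (P231E hc ha hb) scalerA.
by rewrite [(r + n) * (p + n)]mulrC [(r + n) * (q + n)]mulrC sgnzM scale1r.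
Qed.

End PermutationMapsTheory.

Record coalgebra (K : comPzRingType) := Coalgebra {
  co_mod :> lmodType K;
  co_mul : {linear co_mod -> tens co_mod co_mod};
  co_mulA : forall x,
    tassoc (tmap co_mul id (co_mul x)) = tmap id co_mul (co_mul x) }.

Section RepresentationAlgebra.
Variables (K : comPzRingType) (A : gradedAlg K) (M : coalgebra K).
Implicit Types (a b : A) (al be : M) (p q : int).

Inductive aterm : Type :=
| AGen of A & M
| AZero
| AAdd of aterm & aterm
| AScale of K & aterm
| AMul of aterm & aterm.

(* The congruence generated by the axioms of (nonunital) associative algebras
   and the defining relations of A_M.  In acong_prod the list s is any
   expression of the comultiplication of al as a sum of pure tensors. *)
Inductive acong : aterm -> aterm -> Prop :=
| acong_linl k a b al :
    acong (AGen (k *: a + b) al) (AAdd (AScale k (AGen a al)) (AGen b al))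
| acong_linr k a al be :
    acong (AGen a (k *: al + be)) (AAdd (AScale k (AGen a al)) (AGen a be))
| acong_prod a b al (s : seq (M * M)) :
    co_mul M al = \sum_(m <- s) m.1 \ox m.2 ->
    acong (AGen (a \m b) al)
      (foldr (fun m t => AAdd (AMul (AGen a m.1) (AGen b m.2)) t) AZero s)
| acong_comm p q a b al be : ga_hom p a -> ga_hom q b ->
    acong (AMul (AGen a al) (AGen b be))
      (AScale (sgnz (p * q)) (AMul (AGen b be) (AGen a al)))
| acong_refl s : acong s s
| acong_sym s t : acong s t -> acong t s
| acong_trans s t r : acong s t -> acong t r -> acong s r
| acong_congD s s' t t' : acong s s' -> acong t t' -> acong (AAdd s t) (AAdd s' t')
| acong_congZ k s s' : acong s s' -> acong (AScale k s) (AScale k s')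
| acong_congM s s' t t' : acong s s' -> acong t t' -> acong (AMul s t) (AMul s' t')
| acong_addA s t r : acong (AAdd s (AAdd t r)) (AAdd (AAdd s t) r)
| acong_addC s t : acong (AAdd s t) (AAdd t s)
| acong_add0 s : acong (AAdd AZero s) s
| acong_addN s : acong (AAdd (AScale (-1) s) s) AZero
| acong_scaleA k l s : acong (AScale k (AScale l s)) (AScale (k * l) s)
| acong_scale1 s : acong (AScale 1 s) s
| acong_scaleDr k s t :
    acong (AScale k (AAdd s t)) (AAdd (AScale k s) (AScale k t))
| acong_scaleDl k l s :
    acong (AScale (k + l) s) (AAdd (AScale k s) (AScale l s))
| acong_mulA s t r : acong (AMul s (AMul t r)) (AMul (AMul s t) r)
| acong_mulDl k s t r :
    acong (AMul (AAdd (AScale k s) t) r) (AAdd (AScale k (AMul s r)) (AMul t r))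
| acong_mulDr k r s t :
    acong (AMul r (AAdd (AScale k s) t)) (AAdd (AScale k (AMul r s)) (AMul r t)).

Definition rep_setoid : modSetoid K :=
  ModSetoid acong_refl acong_sym acong_trans acong_congD acong_congZ
    acong_addA acong_addC acong_add0 acong_addN acong_scaleA acong_scale1
    acong_scaleDr acong_scaleDl.

Definition rep_mod : lmodType K := qmod rep_setoid.

Definition rep_pi (t : aterm) : rep_mod := qpi (S := rep_setoid) t.
Definition rep_repr (x : rep_mod) : aterm := qrepr (S := rep_setoid) x.

Definition rep_gen0 a al : rep_mod := rep_pi (AGen a al).

Definition rep_mul (x y : rep_mod) : rep_mod :=
  rep_pi (AMul (rep_repr x) (rep_repr y)).

Inductive rep_hom : int -> rep_mod -> Prop :=
| rep_hom_gen p a al : ga_hom p a -> rep_hom p (rep_gen0 a al)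
| rep_hom0 p : rep_hom p 0
| rep_homD p x y : rep_hom p x -> rep_hom p y -> rep_hom p (x + y)
| rep_homZ p k x : rep_hom p x -> rep_hom p (k *: x)
| rep_homM p q x y : rep_hom p x -> rep_hom q y -> rep_hom (p + q) (rep_mul x y).

Let piP s t : acong s t -> rep_pi s = rep_pi t.
Proof. by move=> h; apply/qpiP. Qed.

Let piM s t : rep_pi (AMul s t) = rep_mul (rep_pi s) (rep_pi t).
Proof.
by apply/qpiP/acong_congM; apply/acong_sym/(qrepr_pi (S := rep_setoid)).
Qed.
Let piD s t : rep_pi (AAdd s t) = rep_pi s + rep_pi t.
Proof. exact: (qpiD (S := rep_setoid)). Qed.
Let piZ k t : rep_pi (AScale k t) = k *: rep_pi t.
Proof. exact: (qpiZ (S := rep_setoid)). Qed.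
Let piK x : rep_pi (rep_repr x) = x.
Proof. exact: (qreprK (S := rep_setoid)). Qed.
Let pi0 : rep_pi AZero = 0. Proof. by []. Qed.

Lemma rep_mul_bilin : bilin rep_mul.
Proof.
split=> [z k x y|z k x y]; rewrite -(piK x) -(piK y) -(piK z).
  by rewrite -piZ -piD -!piM -piZ -piD; apply/piP/acong_mulDl.
by rewrite -piZ -piD -!piM -piZ -piD; apply/piP/acong_mulDr.
Qed.

Lemma rep_mulA : associative rep_mul.
Proof.
move=> x y z; rewrite -(piK x) -(piK y) -(piK z) -!piM.
exact/piP/acong_mulA.
Qed.

Lemma rep_gen0_bilin : bilin rep_gen0.
Proof.
split=> [al k a b|a k al be].
  have := piP (acong_linl k a b al); rewrite piD piZ; exact.
have := piP (acong_linr k a al be); rewrite piD piZ; exact.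
Qed.

Lemma rep_gen0_prod a b al (s : seq (M * M)) :
  co_mul M al = \sum_(m <- s) m.1 \ox m.2 ->
  rep_gen0 (a \m b) al = \sum_(m <- s) rep_mul (rep_gen0 a m.1) (rep_gen0 b m.2).
Proof.
move=> /acong_prod-/(_ a b)/piP E; rewrite [LHS]E.
elim: s {E} => [|m s IHs] /=; first by rewrite big_nil.
by rewrite piD big_cons IHs piM.
Qed.

Lemma rep_gen0_comm p q a b al be : ga_hom p a -> ga_hom q b ->
  rep_mul (rep_gen0 a al) (rep_gen0 b be) =
  sgnz (p * q) *: rep_mul (rep_gen0 b be) (rep_gen0 a al).
Proof.
move=> ha hb; have := piP (acong_comm al be ha hb).
by rewrite piZ !piM.
Qed.

Lemma rep_ind (P : rep_mod -> Prop) :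
  (forall a al, P (rep_gen0 a al)) -> P 0 ->
  (forall x y, P x -> P y -> P (x + y)) -> (forall k x, P x -> P (k *: x)) ->
  (forall x y, P x -> P y -> P (rep_mul x y)) -> forall x, P x.
Proof.
move=> Pg P0 PD PZ PM x; rewrite -(piK x).
elim: (rep_repr x) => [a al||s IHs t IHt|k s IHs|s IHs t IHt].
- exact: Pg.
- exact: P0.
- by rewrite piD; apply: PD.
- by rewrite piZ; apply: PZ.
- by rewrite piM; apply: PM.
Qed.

Section Universal.
Variables (W : lmodType K) (mulW : W -> W -> W) (f : A -> M -> W).
Hypotheses (mulW_bilin : bilin mulW) (mulWA : associative mulW) (f_bilin : bilin f).
Hypothesis f_prod : forall a b al (s : seq (M * M)),
  co_mul M al = \sum_(m <- s) m.1 \ox m.2 ->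
  f (a \m b) al = \sum_(m <- s) mulW (f a m.1) (f b m.2).
Hypothesis f_comm : forall p q a b al be, ga_hom p a -> ga_hom q b ->
  mulW (f a al) (f b be) = sgnz (p * q) *: mulW (f b be) (f a al).

Fixpoint aeval (t : aterm) : W :=
  match t with
  | AGen a al => f a al
  | AZero => 0
  | AAdd s t => aeval s + aeval t
  | AScale k s => k *: aeval s
  | AMul s t => mulW (aeval s) (aeval t)
  end.

Lemma aeval_cong s t : acong s t -> aeval s = aeval t.
Proof.
case: f_bilin mulW_bilin => fl fr [ml mr].
elim=> //= [k a b al|k a al be|a b al r E|
  s0 t0 r _ -> _ //|s0 s' t0 t' _ -> _ ->//|
  k s0 s' _ ->//|s0 s' t0 t' _ -> _ ->//|s0 t0 r|s0 t0|s0|s0|k l s0|s0|k s0 t0|k l s0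
  |k s0 t0 r|k r s0 t0].
- exact: fl.
- exact: fr.
- rewrite (f_prod _ _ E); elim: r {E} => [|m r IHr] /=; first by rewrite big_nil.
  by rewrite big_cons IHr.
- by rewrite addrA.
- by rewrite addrC.
- by rewrite add0r.
- by rewrite scaleN1r addNr.
- by rewrite scalerA.
- by rewrite scale1r.
- by rewrite scalerDr.
- by rewrite scalerDl.
- exact: ml.
- exact: mr.
Qed.

(* The algebra homomorphism A_M -> W carrying each generator a_al to f a al. *)
Definition rep_lift (x : rep_mod) : W := aeval (rep_repr x).

Let rep_lift_pi t : rep_lift (rep_pi t) = aeval t.
Proof. exact: aeval_cong (qrepr_pi (S := rep_setoid) t). Qed.

Lemma rep_lift_gen a al : rep_lift (rep_gen0 a al) = f a al.
Proof. exact: rep_lift_pi. Qed.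
Lemma rep_lift_linear : linear rep_lift.
Proof. by move=> k x y; rewrite -(piK x) -(piK y) -piZ -piD !rep_lift_pi. Qed.
Lemma rep_lift_mul x y : rep_lift (rep_mul x y) = mulW (rep_lift x) (rep_lift y).
Proof. by rewrite -(piK x) -(piK y) -piM !rep_lift_pi. Qed.

End Universal.

(* A term as a list of homogeneous summands with their degrees; used only to
   show that the submodules rep_hom p form a direct sum. *)
Definition csupp a : seq int := projT1 (cid (comp_seq a)).
Fixpoint rep_dec (t : aterm) : seq (int * rep_mod) :=
  match t with
  | AGen a al => [seq (p, rep_gen0 (gcomp a p) al) | p <- csupp a]
  | AZero => [::]
  | AAdd s t => rep_dec s ++ rep_dec t
  | AScale k s => [seq (e.1, k *: e.2) | e <- rep_dec s]
  | AMul s t =>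
      [seq (d.1 + e.1, rep_mul d.2 e.2) | d <- rep_dec s, e <- rep_dec t]
  end.

Definition rep_proj0 (p : int) (t : aterm) : rep_mod :=
  \sum_(e <- rep_dec t | e.1 == p) e.2.

Let mul0l y : rep_mul 0 y = 0.
Proof. by apply: (@linear_fun0 _ _ _ (rep_mul^~ y)); case: rep_mul_bilin. Qed.
Let mul0r x : rep_mul x 0 = 0.
Proof. by apply: linear_fun0; case: rep_mul_bilin. Qed.
Let mulsl I (r : seq I) (P : pred I) (F : I -> rep_mod) y :
  rep_mul (\sum_(i <- r | P i) F i) y = \sum_(i <- r | P i) rep_mul (F i) y.
Proof.
by apply: (@linear_fun_sum _ _ _ (rep_mul^~ y)); case: rep_mul_bilin.
Qed.
Let mulsr I (r : seq I) (P : pred I) (F : I -> rep_mod) y :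
  rep_mul y (\sum_(i <- r | P i) F i) = \sum_(i <- r | P i) rep_mul y (F i).
Proof. by apply: linear_fun_sum; case: rep_mul_bilin. Qed.
Let genl al : linear (fun a => rep_gen0 a al).
Proof. by case: rep_gen0_bilin. Qed.

Let proj0_gen p a al : rep_proj0 p (AGen a al) = rep_gen0 (gcomp a p) al.
Proof.
rewrite /rep_proj0 /= /csupp; case: cid => s [us hs _] /=.
rewrite big_map /= -big_filter; case: (boolP (p \in s)) => ps.
  by rewrite (eq_filter (a2 := pred1 p)) // filter_pred1_uniq // big_seq1.
have /eqP-> : gcomp a p == 0 by apply: contraR ps => /hs.
rewrite (linear_fun0 (genl al)) big_filter big_seq_cond big1 // => i.
by case/andP=> is_ /eqP ip; rewrite -ip is_ in ps.
Qed.

Let proj0D p s t : rep_proj0 p (AAdd s t) = rep_proj0 p s + rep_proj0 p t.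
Proof. by rewrite /rep_proj0 /= big_cat. Qed.
Let proj0Z p k s : rep_proj0 p (AScale k s) = k *: rep_proj0 p s.
Proof. by rewrite /rep_proj0 /= big_map scaler_sumr. Qed.
Let proj0M p s t : rep_proj0 p (AMul s t) =
  \sum_(d <- rep_dec s) \sum_(e <- rep_dec t | d.1 + e.1 == p) rep_mul d.2 e.2.
Proof. rewrite /rep_proj0 /= big_mkcond big_allpairs_dep /=; apply: eq_bigr => d _.
by rewrite [RHS]big_mkcond. Qed.

Let proj0Ml p s t : rep_proj0 p (AMul s t) =
  \sum_(e <- rep_dec t) rep_mul (rep_proj0 (p - e.1) s) e.2.
Proof.
rewrite proj0M (exchange_big_dep xpredT) //=; apply: eq_bigr => e _.
by rewrite mulsl; apply: eq_bigl => d; rewrite eq_sym -subr_eq eq_sym.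
Qed.
Let proj0Mr p s t : rep_proj0 p (AMul s t) =
  \sum_(d <- rep_dec s) rep_mul d.2 (rep_proj0 (p - d.1) t).
Proof.
rewrite proj0M; apply: eq_bigr => d _.
rewrite mulsr; apply: eq_bigl => e.
by rewrite addrC eq_sym -subr_eq eq_sym.
Qed.

Let comp_mul a b p (s t : seq int) : uniq s -> uniq t ->
  a = \sum_(i <- s) gcomp a i -> b = \sum_(j <- t) gcomp b j ->
  gcomp (a \m b) p =
  \sum_(i <- s) \sum_(j <- t | i + j == p) gcomp a i \m gcomp b j.
Proof.
move=> us ut aE bE; have [ml mr] := ga_mul_bilin A.
rewrite {1}aE {1}bE (@linear_fun_sum _ _ _ (fun a => a \m _) _ _ _ _ (ml _)).
rewrite (linear_fun_sum _ _ _ (comp_linear p)); apply: eq_bigr => i _.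
rewrite (linear_fun_sum _ _ _ (mr _)) (linear_fun_sum _ _ _ (comp_linear p)).
rewrite [RHS]big_mkcond; apply: eq_bigr => j _.
by rewrite (compE (ga_hom_mul (comp_hom a i) (comp_hom b j))) eq_sym.
Qed.

Let proj0_gen2 a b al be p :
  rep_proj0 p (AMul (AGen a al) (AGen b be)) =
  \sum_(i <- csupp a) \sum_(j <- csupp b | i + j == p)
    rep_mul (rep_gen0 (gcomp a i) al) (rep_gen0 (gcomp b j) be).
Proof. by rewrite proj0M /= big_map; apply: eq_bigr => i _; rewrite big_map. Qed.

Lemma rep_proj0_cong p s t : acong s t -> rep_proj0 p s = rep_proj0 p t.
Proof.
have [gl gr] := rep_gen0_bilin.
move=> h; elim: h p => {s t}.
- by move=> k a b al p; rewrite proj0D proj0Z !proj0_gen comp_linear gl.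
- by move=> k a al be p; rewrite proj0D proj0Z !proj0_gen gr.
- move=> a b al s E p; rewrite proj0_gen.
  transitivity (\sum_(m <- s) rep_proj0 p (AMul (AGen a m.1) (AGen b m.2)));
    last first.
    elim: s {E} => [|m s IHs] /=; first by rewrite big_nil /rep_proj0 big_nil.
    by rewrite proj0D big_cons IHs.
  have [ur _ rE] := projT2 (cid (comp_seq a)).
  have [ut _ tE] := projT2 (cid (comp_seq b)).
  rewrite (comp_mul p ur ut rE tE) (linear_fun_sum _ _ _ (genl al)).
  under [RHS]eq_bigr => m _ do rewrite proj0_gen2.
  rewrite exchange_big; apply: eq_bigr => i _ /=.
  rewrite (linear_fun_sum _ _ _ (genl al)) [RHS]exchange_big /=.
  by apply: eq_bigr => j _; apply: rep_gen0_prod.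
- move=> p q a b al be ha hb r; rewrite proj0Z.
  rewrite !proj0_gen2 scaler_sumr (exchange_big_dep xpredT) //=.
  apply: eq_bigr => j _; rewrite scaler_sumr.
  rewrite (eq_bigl (fun i => j + i == r)) => [|i]; last by rewrite addrC.
  apply: eq_bigr => i _; apply: rep_gen0_comm.
    by rewrite (compE ha); case: eqP => // _; apply: hom0.
  by rewrite (compE hb); case: eqP => // _; apply: hom0.
- by [].
- by move=> s t _ IH p; rewrite IH.
- by move=> s t r _ IH1 _ IH2 p; rewrite IH1.
- by move=> s s' t t' _ IH1 _ IH2 p; rewrite !proj0D IH1 IH2.
- by move=> k s s' _ IH p; rewrite !proj0Z IH.
- move=> s s' t t' _ IH1 _ IH2 p; rewrite proj0Ml.
  under eq_bigr => e _ do rewrite IH1.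
  rewrite -proj0Ml proj0Mr; under eq_bigr => e _ do rewrite IH2.
  by rewrite -proj0Mr.
- by move=> s t r p; rewrite !proj0D addrA.
- by move=> s t p; rewrite !proj0D addrC.
- by move=> s p; rewrite !proj0D /rep_proj0 big_nil add0r.
- by move=> s p; rewrite proj0D proj0Z scaleN1r addNr /rep_proj0 big_nil.
- by move=> k l s p; rewrite !proj0Z scalerA.
- by move=> s p; rewrite proj0Z scale1r.
- by move=> k s t p; rewrite !proj0Z !proj0D !proj0Z scalerDr.
- by move=> k l s p; rewrite !proj0D !proj0Z scalerDl.
- move=> s t r p; rewrite proj0Ml [RHS]proj0Ml.
  rewrite /= big_allpairs_dep exchange_big; apply: eq_bigr => f _ /=.
  rewrite proj0Ml mulsl; apply: eq_bigr => d _.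
  by rewrite rep_mulA opprD addrA addrAC.
- move=> k s t r p; rewrite proj0D proj0Z !proj0Ml scaler_sumr -big_split.
  apply: eq_bigr => e _ /=; rewrite proj0D proj0Z.
  by case: rep_mul_bilin => ml _; rewrite ml.
- move=> k r s t p; rewrite proj0D proj0Z !proj0Mr scaler_sumr -big_split.
  apply: eq_bigr => e _ /=; rewrite proj0D proj0Z.
  by case: rep_mul_bilin => _ mr; rewrite mr.
Qed.

Definition rep_proj (p : int) (x : rep_mod) : rep_mod := rep_proj0 p (rep_repr x).

Let projE p t : rep_proj p (rep_pi t) = rep_proj0 p t.
Proof. exact: rep_proj0_cong (qrepr_pi (S := rep_setoid) t). Qed.

Lemma rep_proj_linear p : linear (rep_proj p).
Proof.
by move=> k x y; rewrite -(piK x) -(piK y) -piZ -piD !projE proj0D proj0Z.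
Qed.

Lemma rep_hom_sum I (r : seq I) (P : pred I) (F : I -> rep_mod) p :
  (forall i, P i -> rep_hom p (F i)) -> rep_hom p (\sum_(i <- r | P i) F i).
Proof.
by move=> h; apply: big_ind => //; [exact: rep_hom0|exact: rep_homD].
Qed.

Lemma rep_hom_submodule p : submodule (rep_hom p).
Proof.
by split=> [|k x y hx hy]; [exact: rep_hom0|apply/rep_homD/hy/rep_homZ].
Qed.

Let dec_hom t e : e \in rep_dec t -> rep_hom e.1 e.2.
Proof.
elim: t e => [a al||s IHs t IHt|k s IHs|s IHs t IHt] e //=.
- by case/mapP=> p _ ->; apply/rep_hom_gen/comp_hom.
- by rewrite mem_cat => /orP[/IHs|/IHt].
- by case/mapP=> f /IHs h ->; apply: rep_homZ.
- by case/allpairsP=> [[d f]] [/IHs hd /IHt hf ->]; apply: rep_homM.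
Qed.

Let dec_sum t : rep_pi t = \sum_(e <- rep_dec t) e.2.
Proof.
elim: t => [a al||s IHs t IHt|k s IHs|s IHs t IHt] /=.
- rewrite big_map /= /csupp; case: cid => s /= [_ _ aE].
  by rewrite -(linear_fun_sum _ _ _ (genl al)) -aE.
- by rewrite big_nil.
- by rewrite piD IHs IHt big_cat.
- by rewrite piZ IHs big_map scaler_sumr.
- rewrite piM IHs IHt mulsl big_allpairs_dep; apply: eq_bigr => d _.
  by rewrite mulsr.
Qed.

Let proj_hom p x q : rep_hom q x -> rep_proj p x = if p == q then x else 0.
Proof.
move=> h; elim: h p => {q x} [p a al ha q|p q|p x y _ IHx _ IHy q|p k x _ IHx q
  |p q x y _ IHx _ IHy r].
- rewrite /rep_gen0 projE proj0_gen (compE ha); case: eqP => // _.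
  exact: linear_fun0 (genl al).
- by rewrite (linear_fun0 (rep_proj_linear q)) if_same.
- rewrite (linear_funD _ _ (rep_proj_linear q)) IHx IHy.
  by case: eqP => // _; rewrite addr0.
- rewrite (linear_funZ _ _ (rep_proj_linear q)) IHx.
  by case: eqP => // _; rewrite scaler0.
rewrite -{1}(piK x) -{1}(piK y) -piM projE proj0Ml.
transitivity (rep_mul x (rep_proj (r - p) y)).
  rewrite [rep_proj _ y]/rep_proj [rep_proj0 _ (rep_repr y)]/rep_proj0 mulsr.
  rewrite [RHS]big_mkcond; apply: eq_bigr => e _.
  rewrite -/(rep_proj _ x) IHx; have -> : (r - e.1 == p) = (e.1 == r - p).
    by rewrite subr_eq eq_sym [RHS]eq_sym subr_eq eq_sym [RHS]eq_sym addrC.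
  by case: eqP => // _; rewrite mul0l.
rewrite IHy subr_eq addrC; case: eqP => // _; exact: mul0r.
Qed.

Lemma rep_direct : direct_sum rep_hom.
Proof.
apply: (direct_sum_proj (P := rep_proj)).
- exact: rep_hom_submodule.
- exact: rep_proj_linear.
- move=> p x; rewrite -(piK x) projE /rep_proj0 big_seq_cond.
  by apply: rep_hom_sum => e /andP[/dec_hom h /eqP <-].
- by move=> p q x; apply: proj_hom.
- move=> x; exists (rep_dec (rep_repr x)); split; first exact: dec_hom.
  by rewrite -dec_sum piK.
Qed.

(* The algebra A_M. *)
Definition repAlg : gradedAlg K :=
  GradedAlg rep_mul_bilin rep_mulA rep_direct (@rep_homM).

(* The generator a_al of A_M. *)
Definition rgen (a : A) (al : M) : repAlg := rep_gen0 a al.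

End RepresentationAlgebra.

Arguments rgen {K A M} a al.

Section QuotientAlgebra.
Variables (K : comPzRingType) (B : gradedAlg K) (S : set B).

(* The two-sided ideal of B generated by S; B need not have a unit. *)
Inductive ideal_gen : B -> Prop :=
| ideal_gen_in x : S x -> ideal_gen x
| ideal_gen0 : ideal_gen 0
| ideal_genD x y : ideal_gen x -> ideal_gen y -> ideal_gen (x + y)
| ideal_genZ k x : ideal_gen x -> ideal_gen (k *: x)
| ideal_genMl b x : ideal_gen x -> ideal_gen (b \m x)
| ideal_genMr b x : ideal_gen x -> ideal_gen (x \m b).

Definition ideal_eq (x y : B) : Prop := ideal_gen (x - y).

Lemma ideal_genN x : ideal_gen x -> ideal_gen (- x).
Proof. by rewrite -scaleN1r; apply: ideal_genZ. Qed.

Lemma ideal_eq_of (x y : B) : x = y -> ideal_eq x y.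
Proof. by move=> ->; rewrite /ideal_eq subrr; apply: ideal_gen0. Qed.
Lemma ideal_eq_sym (x y : B) : ideal_eq x y -> ideal_eq y x.
Proof. by move=> /ideal_genN; rewrite opprB. Qed.
Lemma ideal_eq_trans (x y z : B) : ideal_eq x y -> ideal_eq y z -> ideal_eq x z.
Proof. by move=> h1 h2; have := ideal_genD h1 h2; rewrite addrA subrK. Qed.
Lemma ideal_eqD (x x' y y' : B) :
  ideal_eq x x' -> ideal_eq y y' -> ideal_eq (x + y) (x' + y').
Proof. by move=> h1 h2; have := ideal_genD h1 h2; rewrite addrACA -opprD. Qed.
Lemma ideal_eqZ k (x x' : B) : ideal_eq x x' -> ideal_eq (k *: x) (k *: x').
Proof. by move=> h; have := ideal_genZ k h; rewrite scalerBr. Qed.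

Definition quot_setoid : modSetoid K.
Proof.
refine (@ModSetoid K B ideal_eq 0 +%R *:%R _ ideal_eq_sym ideal_eq_trans
  ideal_eqD ideal_eqZ _ _ _ _ _ _ _ _) => *; apply: ideal_eq_of => //.
- by rewrite addrA.
- by rewrite addrC.
- by rewrite add0r.
- by rewrite scaleN1r addNr.
- by rewrite scalerA.
- by rewrite scale1r.
- by rewrite scalerDr.
- by rewrite scalerDl.
Defined.

Definition quot_mod : lmodType K := qmod quot_setoid.
Definition quot_pi0 (x : B) : quot_mod := qpi (S := quot_setoid) x.
Definition quot_repr (x : quot_mod) : B := qrepr (S := quot_setoid) x.
Definition quot_mul (x y : quot_mod) : quot_mod :=
  quot_pi0 (quot_repr x \m quot_repr y).
Definition quot_hom (p : int) (y : quot_mod) : Prop :=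
  exists2 x : B, ga_hom p x & quot_pi0 x = y.

Let piP x y : quot_pi0 x = quot_pi0 y <-> ideal_eq x y.
Proof. exact: (qpiP (S := quot_setoid)). Qed.
Let piK x : quot_pi0 (quot_repr x) = x.
Proof. exact: (qreprK (S := quot_setoid)). Qed.
Let repr_pi x : ideal_eq (quot_repr (quot_pi0 x)) x.
Proof. by apply/piP; rewrite piK. Qed.

Lemma quot_pi0_linear : linear quot_pi0.
Proof.
move=> k x y; transitivity (quot_pi0 (k *: x) + quot_pi0 y).
  exact: (qpiD (S := quot_setoid)).
by congr (_ + _); apply: (qpiZ (S := quot_setoid)).
Qed.

Let mulB (x x' y y' : B) : x \m y - x' \m y' = (x - x') \m y + x' \m (y - y').
Proof.
have [ml mr] := ga_mul_bilin B.
have mBl (a b c : B) : (a - b) \m c = a \m c - b \m c.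
  by rewrite -scaleN1r addrC ml scaleN1r addrC.
have mBr (a b c : B) : c \m (a - b) = c \m a - c \m b.
  by rewrite -scaleN1r addrC mr scaleN1r addrC.
by rewrite mBl mBr addrA subrK.
Qed.

Lemma quot_pi0_mul x y : quot_pi0 (x \m y) = quot_mul (quot_pi0 x) (quot_pi0 y).
Proof.
apply/piP/ideal_eq_sym; rewrite /ideal_eq mulB.
by apply: ideal_genD; [apply: ideal_genMr|apply: ideal_genMl]; apply: repr_pi.
Qed.

Lemma quot_mul_bilin : bilin quot_mul.
Proof.
have [ml mr] := ga_mul_bilin B.
split=> [z k x y|z k x y]; rewrite -(piK x) -(piK y) -(piK z).
  by rewrite -quot_pi0_linear -!quot_pi0_mul ml quot_pi0_linear.
by rewrite -quot_pi0_linear -!quot_pi0_mul mr quot_pi0_linear.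
Qed.

Lemma quot_mulA : associative quot_mul.
Proof.
by move=> x y z; rewrite -(piK x) -(piK y) -(piK z) -!quot_pi0_mul ga_mulA.
Qed.

Lemma quot_hom_mul p q x y :
  quot_hom p x -> quot_hom q y -> quot_hom (p + q) (quot_mul x y).
Proof.
move=> [x' hx <-] [y' hy <-]; exists (x' \m y'); first exact: ga_hom_mul.
exact: quot_pi0_mul.
Qed.

Hypothesis S_comp : forall x, S x -> forall p, ideal_gen (gcomp x p).

Lemma ideal_gen_sum I (r : seq I) (P : pred I) (F : I -> B) :
  (forall i, P i -> ideal_gen (F i)) -> ideal_gen (\sum_(i <- r | P i) F i).
Proof.
by move=> h; apply: big_ind => //; [exact: ideal_gen0|exact: ideal_genD].
Qed.

Let comp_mul (a b : B) p : exists s t : seq int,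
  gcomp (a \m b) p =
  \sum_(i <- s) \sum_(j <- t | p == i + j) gcomp a i \m gcomp b j.
Proof.
have [ml mr] := ga_mul_bilin B.
have [s [_ _ aE]] := comp_seq a; have [t [_ _ bE]] := comp_seq b.
exists s, t; rewrite {1}aE {1}bE (@linear_fun_sum _ _ _ (fun a => a \m _) _ _ _ _ (ml _)).
rewrite (linear_fun_sum _ _ _ (comp_linear p)); apply: eq_bigr => i _.
rewrite (linear_fun_sum _ _ _ (mr _)) (linear_fun_sum _ _ _ (comp_linear p)).
rewrite [RHS]big_mkcond; apply: eq_bigr => j _.
by rewrite (compE (ga_hom_mul (comp_hom a i) (comp_hom b j))).
Qed.

Lemma ideal_gen_comp x p : ideal_gen x -> ideal_gen (gcomp x p).
Proof.
move=> h; elim: h p => {x} [x Sx p||x y _ IHx _ IHy p|k x _ IHx p|b x _ IHx p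
  |b x _ IHx p].
- exact: S_comp.
- by move=> p; rewrite (linear_fun0 (comp_linear p)); apply: ideal_gen0.
- by rewrite (linear_funD _ _ (comp_linear p)); apply: ideal_genD.
- by rewrite (linear_funZ _ _ (comp_linear p)); apply: ideal_genZ.
- have [s [t ->]] := comp_mul b x p.
  by apply: ideal_gen_sum => i _; apply: ideal_gen_sum => j _; apply: ideal_genMl.
have [s [t ->]] := comp_mul x b p.
by apply: ideal_gen_sum => i _; apply: ideal_gen_sum => j _; apply: ideal_genMr.
Qed.

Let proj p (y : quot_mod) : quot_mod := quot_pi0 (gcomp (quot_repr y) p).
Let projE p x : proj p (quot_pi0 x) = quot_pi0 (gcomp x p).
Proof.
apply/piP; have /(ideal_gen_comp p) := repr_pi x.
by rewrite -scaleN1r addrC comp_linear scaleN1r addrC.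
Qed.

Lemma quot_direct : direct_sum quot_hom.
Proof.
apply: (direct_sum_proj (P := proj)).
- move=> p; split=> [|k _ _ [x hx <-] [y hy <-]].
    by exists 0; [exact: hom0|exact: (linear_fun0 quot_pi0_linear)].
  by exists (k *: x + y); [exact: homZD|exact: quot_pi0_linear].
- move=> p k x y; rewrite -(piK x) -(piK y) -quot_pi0_linear !projE.
  by rewrite comp_linear quot_pi0_linear.
- by move=> p x; exists (gcomp (quot_repr x) p) => //; apply: comp_hom.
- move=> p q _ [x hx <-]; rewrite projE (compE hx); case: (eqVneq p q) => // _.
- move=> y; have [s [_ _ xE]] := comp_seq (quot_repr y).
  exists [seq (p, proj p y) | p <- s]; split=> [_ /mapP[p _ ->]|].
    by exists (gcomp (quot_repr y) p) => //; apply: comp_hom.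
  by rewrite big_map -{1}(piK y) {1}xE (linear_fun_sum _ _ _ quot_pi0_linear).
Qed.

(* B modulo the ideal generated by S, with the grading induced from B. *)
Definition quotAlg : gradedAlg K :=
  GradedAlg quot_mul_bilin quot_mulA quot_direct quot_hom_mul.

Definition quot_pi (x : B) : quotAlg := quot_pi0 x.

Lemma quot_piP x y : quot_pi x = quot_pi y <-> ideal_gen (x - y).
Proof. exact: piP. Qed.
Lemma quot_pi_surj (y : quotAlg) : exists x, quot_pi x = y.
Proof. by exists (quot_repr y); apply: piK. Qed.
Lemma quot_pi_linear : linear quot_pi.
Proof. exact: quot_pi0_linear. Qed.
Lemma quot_pi_mul x y : quot_pi (x \m y) = quot_pi x \m quot_pi y.
Proof. exact: quot_pi0_mul. Qed.

End QuotientAlgebra.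

Record enrichedGroup := EnrichedGroup {
  eg_group :> groupType;
  eg_sub : set eg_group;
  eg_sub1 : eg_sub 1%g;
  eg_subM : forall g h, eg_sub g -> eg_sub h -> eg_sub (g * h)%g;
  eg_subV : forall g, eg_sub g -> eg_sub g^-1%g;
  eg_index : let lcosets := range (fun g => [set (g * h)%g | h in eg_sub]) in
    (lcosets #= `I_1 \/ lcosets #= `I_2)%card }.

Section Automorphisms.
Variable K : comPzRingType.

Definition graded_linear_iso (A : gradedAlg K) (f : A -> A) : Prop :=
  [/\ linear f, bijective f & forall p a, ga_hom p a -> ga_hom p (f a)].

Definition graded_aut (A : gradedAlg K) (f : A -> A) : Prop :=
  graded_linear_iso f /\ forall a b, f (a \m b) = f a \m f b.

Definition graded_antiaut (A : gradedAlg K) (f : A -> A) : Prop :=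
  graded_linear_iso f /\ forall p q a b, ga_hom p a -> ga_hom q b ->
    f (a \m b) = sgnz (p * q) *: (f b \m f a).

Definition co_aut (M : coalgebra K) (h : M -> M) : Prop :=
  [/\ linear h, bijective h
    & forall x, tmap h h (co_mul M x) = co_mul M (h x)].

Definition co_antiaut (M : coalgebra K) (h : M -> M) : Prop :=
  [/\ linear h, bijective h
    & forall x, tmap h h (co_mul M x) = tflip (co_mul M (h x))].

End Automorphisms.

Definition is_left_action (G : groupType) (X : Type) (act : G -> X -> X) : Prop :=
  (forall x, act 1%g x = x) /\ (forall g h x, act (g * h)%g x = act g (act h x)).

Record gradedGAlg (K : comPzRingType) (G : enrichedGroup) := GradedGAlg {
  gga_alg :> gradedAlg K;
  gga_act : G -> gga_alg -> gga_alg;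
  gga_action : is_left_action gga_act;
  gga_aut : forall g, eg_sub g -> graded_aut (gga_act g);
  gga_antiaut : forall g, ~ eg_sub g -> graded_antiaut (gga_act g) }.

Record gCoalg (K : comPzRingType) (G : enrichedGroup) := GCoalg {
  gco_coalg :> coalgebra K;
  gco_act : G -> gco_coalg -> gco_coalg;
  gco_action : is_left_action gco_act;
  gco_aut : forall g, eg_sub g -> co_aut (gco_act g);
  gco_antiaut : forall g, ~ eg_sub g -> co_antiaut (gco_act g) }.

Section CoinvariantAlgebra.
Variables (K : comPzRingType) (G : enrichedGroup).
Variables (A : gradedGAlg K G) (M : gCoalg K G).

Definition coinv_rel : set (repAlg A M) :=
  [set x | exists g a al, x = rgen (gga_act g a) (gco_act g al) - rgen a al].

Lemma rgen_bilin : bilin (@rgen K A M).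
Proof. exact: rep_gen0_bilin. Qed.

Lemma comp_rgen (a : A) (al : M) p :
  gcomp (rgen a al : repAlg A M) p = rgen (gcomp a p) al.
Proof.
have [gl _] := rgen_bilin; have [s [us hs aE]] := comp_seq a.
rewrite {1}aE (linear_fun_sum _ _ _ (gl al)).
rewrite (linear_fun_sum _ _ _ (comp_linear p)).
rewrite (eq_bigr (fun i => if i == p then rgen (gcomp a i) al else 0)); last first.
  move=> i _; rewrite (@compE _ _ i) 1?eq_sym //.
  exact/rep_hom_gen/comp_hom.
rewrite -big_mkcond -big_filter; case: (boolP (p \in s)) => ps.
  by rewrite filter_pred1_uniq // big_seq1.
have /eqP-> : gcomp a p == 0 by apply: contraR ps => /hs.
rewrite (linear_fun0 (gl al)) big_filter big_seq_cond big1 // => i.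
by case/andP=> is_ /eqP ip; rewrite -ip is_ in ps.
Qed.

Lemma gga_iso g : graded_linear_iso (@gga_act K G A g).
Proof.
by have [h|h] := pselect (eg_sub g); [case: (gga_aut A h)|case: (gga_antiaut A h)].
Qed.

Lemma comp_act g (a : A) p : gcomp (gga_act g a) p = gga_act g (gcomp a p).
Proof.
have [fl _ fh] := gga_iso g; have [s [us hs aE]] := comp_seq a.
rewrite {1}aE (linear_fun_sum _ _ _ fl) (linear_fun_sum _ _ _ (comp_linear p)).
rewrite (eq_bigr (fun i => if i == p then gga_act g (gcomp a i) else 0)); last first.
  by move=> i _; rewrite (compE (fh i _ (comp_hom a i))) eq_sym.
rewrite -big_mkcond -big_filter; case: (boolP (p \in s)) => ps.
  by rewrite filter_pred1_uniq // big_seq1.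
have /eqP-> : gcomp a p == 0 by apply: contraR ps => /hs.
rewrite (linear_fun0 fl) big_filter big_seq_cond big1 // => i.
by case/andP=> is_ /eqP ip; rewrite -ip is_ in ps.
Qed.

Lemma coinv_rel_comp (x : repAlg A M) :
  coinv_rel x -> forall p, ideal_gen coinv_rel (gcomp x p).
Proof.
move=> [g [a [al ->]]] p; apply: ideal_gen_in; exists g, (gcomp a p), al.
by rewrite -scaleN1r addrC comp_linear scaleN1r addrC !comp_rgen comp_act.
Qed.

(* The algebra A_M^G and the projection q : A_M -> A_M^G. *)
Definition coinvAlg : gradedAlg K := quotAlg coinv_rel_comp.
Definition coinv_proj (x : repAlg A M) : coinvAlg := quot_pi coinv_rel_comp x.

End CoinvariantAlgebra.

Section Brackets.
Variables (K : comPzRingType) (B : gradedAlg K) (n : int).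

Record biderivation (br : B -> B -> B) : Prop := Biderivation {
  bd_bilin : bilin br;
  bd_degree : forall p q a b, ga_hom p a -> ga_hom q b ->
    ga_hom (p + q + n) (br a b);
  bd_leibnizr : forall p q r a b c,
    ga_hom p a -> ga_hom q b -> ga_hom r c ->
    br a (b \m c) = br a b \m c + sgnz ((p + n) * q) *: (b \m br a c);
  bd_leibnizl : forall p q r a b c,
    ga_hom p a -> ga_hom q b -> ga_hom r c ->
    br (a \m b) c = a \m br b c + sgnz (q * (r + n)) *: (br a c \m b);
  bd_antisym : forall p q a b, ga_hom p a -> ga_hom q b ->
    br a b = - (sgnz ((p + n) * (q + n)) *: br b a) }.

Definition gerstenhaber (br : B -> B -> B) : Prop :=
  biderivation br /\
  forall p q r a b c, ga_hom p a -> ga_hom q b -> ga_hom r c ->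
    sgnz ((p + n) * (r + n)) *: br a (br b c) +
    sgnz ((q + n) * (p + n)) *: br b (br c a) +
    sgnz ((r + n) * (q + n)) *: br c (br a b) = 0.

End Brackets.

Section DoubleBrackets.
Variables (K : comPzRingType) (A : gradedAlg K) (n : int).

(* The degree d part of the tensor square. *)
Inductive tens_hom (d : int) : tens A A -> Prop :=
| tens_hom_pure i j (a b : A) : ga_hom i a -> ga_hom j b -> i + j = d ->
    tens_hom d (a \ox b)
| tens_hom0 : tens_hom d 0
| tens_homD x y : tens_hom d x -> tens_hom d y -> tens_hom d (x + y).

(* The maps a (x (x) y) = a x (x) y and (x (x) y) b = x (x) y b. *)
Definition outerl (a : A) : tens A A -> tens A A :=
  tlift (fun x y : A => (a \m x) \ox y).
Definition outerr (z : tens A A) (b : A) : tens A A :=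
  tlift (fun x y : A => x \ox (y \m b)) z.

(* The maps a * (x (x) y) = (-1)^(|a||x|) x (x) a y and
   (x (x) y) * b = (-1)^(|b||y|) x b (x) y, for a, b of the given degree. *)
Definition innerl (p : int) (a : A) : tens A A -> tens A A :=
  tlift (fun x y : A =>
    hsum (fun i (x : A) => sgnz (p * i) *: (x \ox (a \m y))) x).
Definition innerr (z : tens A A) (q : int) (b : A) : tens A A :=
  tlift (fun x y : A =>
    hsum (fun j (y : A) => sgnz (q * j) *: ((x \m b) \ox y)) y) z.

Record double_bracket (db : {linear tens A A -> tens A A}) : Prop := DoubleBracket {
  db_degree : forall p q (a b : A), ga_hom p a -> ga_hom q b ->
    tens_hom (p + q + n) (db (a \ox b));
  db_antisym : forall x, db (P21 n x) = - P21 0 (db x);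
  db_leibnizr : forall p q r (a b c : A),
    ga_hom p a -> ga_hom q b -> ga_hom r c ->
    db (a \ox (b \m c)) =
      outerr (db (a \ox b)) c + sgnz ((p + n) * q) *: outerl b (db (a \ox c));
  db_leibnizl : forall p q r (a b c : A),
    ga_hom p a -> ga_hom q b -> ga_hom r c ->
    db ((a \m b) \ox c) =
      innerl p a (db (b \ox c)) +
      sgnz (q * (r + n)) *: innerr (db (a \ox c)) q b }.

Definition tribracket (db : tens A A -> tens A A) (x : tens A (tens A A)) :
    tens A (tens A A) :=
  let db_id y := tassoc (tmap db id (tassoc_inv y)) in
  let id_db y := tmap id db y in
  \sum_(i < 3) iter i (@P312 K A 0) (db_id (id_db (iter i (@P231 K A n) x))).

Definition double_gerstenhaber (db : {linear tens A A -> tens A A}) : Prop :=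
  double_bracket db /\ forall x, tribracket db x = 0.

End DoubleBrackets.

Definition equivariant_bracket (K : comPzRingType) (G : enrichedGroup)
    (A : gradedGAlg K G) (db : tens A A -> tens A A) : Prop :=
  forall (g : G) (a b : A),
    let gab := tmap (@gga_act K G A g) (@gga_act K G A g) (db (a \ox b)) in
    (eg_sub g -> db (gga_act g a \ox gga_act g b) = gab) /\
    (~ eg_sub g -> db (gga_act g a \ox gga_act g b) = P21 0 gab).

Section Forms.
Variables (K : comPzRingType) (M : coalgebra K).

(* The linear extension of f evaluated on al^1 (x) al^2 (x) al^3. *)
Definition sweedler3 (W : lmodType K) (f : M -> M -> M -> W) (al : M) : W :=
  tlift3 f (tmap id (co_mul M) (co_mul M al)).

Definition form_hat (v : tens M M -> K) : tens M M -> tens M M :=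
  tlift (fun al be =>
    sweedler3 (fun be1 be2 be3 => v (al \ox be2) *: (be1 \ox be3)) be).

Definition cyclic_form (v : tens M M -> K) : Prop :=
  forall x, form_hat v (tflip x) = tflip (form_hat v x).

End Forms.

Definition equivariant_form (K : comPzRingType) (G : enrichedGroup)
    (M : gCoalg K G) (v : tens M M -> K) : Prop :=
  forall (g : G) (al be : M),
    v (gco_act g al \ox gco_act g be) = v (al \ox be).

(* br is the biderivation in A_M derived from db and v. *)
Definition derived_bracket (K : comPzRingType) (A : gradedAlg K)
    (M : coalgebra K) (n : int) (db : tens A A -> tens A A)
    (v : tens M M -> K) (br : repAlg A M -> repAlg A M -> repAlg A M) : Prop :=
  biderivation n br /\
  forall (a b : A) (al be : M),
    br (rgen a al) (rgen b be) =
    tlift (fun x y : A => sweedler3 (fun be1 be2 be3 =>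
      v (al \ox be2) *: (rgen x be1 \m rgen y be3)) be) (db (a \ox b)).

(* Main.v *)
Require Import Defs.
From HB Require Import structures.
From mathcomp Require Import all_boot all_order all_algebra.
From mathcomp Require Import zify.
From mathcomp Require Import boolp classical_sets functions cardinality fsbigop.

Set Implicit Arguments.
Unset Strict Implicit.
Unset Printing Implicit Defensive.

Import GRing.Theory.
Local Open Scope classical_set_scope.
Local Open Scope ring_scope.

(** Below, [D_al be] stands for the contraction [v (al (x) be2) be1 (x) be3], an element
of [M (x) M].

Existence.  The group acts on [A_M] by [g a_al = (g a)_(g al)]: an element outside
the distinguished subgroup reverses products in [A] and coproducts in [M], and in
the graded commutative algebra [A_M] the two reversals cancel ([rep_act_mul]).  By
equivariance of the double bracket and of the form, the derived bracket is
invariant under this action ([derived_equiv]).  Consequently the averaged map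
[avg x y], the sum over [g] of [q {g x, y}], does not change when [y] is replaced
by [h y]: translating [h] to the first argument permutes the summands
([avg_actr]).  For fixed [x] it is a derivation along [q] that vanishes on the
relations [h y - y], hence on the ideal they generate ([avg_idealr]); antisymmetry
gives the same in the first argument, so [avg] descends to [A_M^G].

Uniqueness.  A biderivation is determined by its values on generators
([bider_along_rgen]).

Jacobi identity on the quotient.  A nested averaged bracket is a double sum over
[g] and [h].  Translating the summation indices brings the three terms of the
Jacobiator of [q x, q y, q z] to sums over the same triples [g x, h y, z], so the
identity reduces to the one for the derived bracket on [A_M]
([avg_bracket_gerstenhaber]).

Jacobi identity on [A_M].  The Jacobiator is a derivation in each argument and
invariant under rotation, so generators suffice ([gerstenhaber_gen]).  There the
bracket is [{a_al, b_be} = ev2 (db (a (x) b)) (D_al be)], and applying the Leibniz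
rule to a nested bracket gives [J (a, b, c) - (sign) J (a, c, b)], where [J] brackets
the first argument with the first leg of the double bracket of the other two
([derived_nested]).  A cyclic sum of terms [J] is the value in [A_M] of the double
Jacobi identity: rotating [a, b, c] permutes the factors of [A (x) A (x) A], and by
coassociativity and cyclicity of [v] it permutes the factors of the contraction in
[M (x) M (x) M] in the same way ([contract_rot]).  The Jacobiator of three
generators is the difference of two such sums ([derived_jacobiator]). *)

(** * Signs *)

Section Signs.
Variable K : pzRingType.
Implicit Types k l : int.

Definition oddz k : bool := odd `|k|%N.

Lemma sgnz_oddz k : sgnz k = (-1) ^+ (oddz k) :> K.
Proof. by rewrite /sgnz /oddz signr_odd. Qed.

Lemma oddzD k l : oddz (k + l) = oddz k (+) oddz l.
Proof. by rewrite /oddz; lia. Qed.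

Lemma oddzM k l : oddz (k * l) = oddz k && oddz l.
Proof. by rewrite /oddz abszM oddM. Qed.

Lemma sgnzD k l : sgnz (k + l) = sgnz k * sgnz l :> K.
Proof. by rewrite !sgnz_oddz oddzD signr_addb. Qed.

End Signs.

(* A sign depends only on the parities of the degrees in its exponent, so an
   identity of signs is a finite check. *)
Ltac by_parity :=
  rewrite ?sgnz_oddz ?(oddzD, oddzM);
  repeat match goal with |- context [oddz ?k] => case: (oddz k) end;
  rewrite /= ?(expr0, expr1, scale1r, scaleN1r, opprK).

(** * Linear maps and tensor products *)

Section LinearMaps.
Variable K : comPzRingType.
Implicit Types U V W : lmodType K.

Lemma linear_comp U V W (f : V -> W) (g : U -> V) :
  linear f -> linear g -> linear (fun x => f (g x)).
Proof. by move=> fl gl k x y; rewrite gl fl. Qed.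

Lemma linear_add U W (f g : U -> W) :
  linear f -> linear g -> linear (fun x => f x + g x).
Proof. by move=> fl gl k x y; rewrite fl gl scalerDr addrACA. Qed.

Lemma linear_sum U W I (r : seq I) (f : I -> U -> W) :
  (forall i, linear (f i)) -> linear (fun x => \sum_(i <- r) f i x).
Proof.
move=> fl k x y; rewrite scaler_sumr -big_split; apply: eq_bigr => i _ /=.
exact: fl.
Qed.

Lemma linear_funN U W (f : U -> W) x : linear f -> f (- x) = - f x.
Proof. by move=> fl; rewrite -scaleN1r (linear_funZ _ _ fl) scaleN1r. Qed.

(** Signs are written down for homogeneous elements only; linear identities follow
from their homogeneous instances, elements being sums of their components. *)
Lemma eq_linear_hom (A : gradedAlg K) W (f g : A -> W) :
  linear f -> linear g -> (forall p a, ga_hom p a -> f a = g a) -> f =1 g.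
Proof.
move=> fl gl fg a; have [s [_ _ ->]] := comp_seq a.
rewrite (linear_fun_sum _ _ _ fl) (linear_fun_sum _ _ _ gl).
by apply: eq_bigr => p _; apply: fg (comp_hom a p).
Qed.

Lemma bilin_comp U V U' V' W (f : U' -> V' -> W) (g : U -> U') (h : V -> V') :
  bilin f -> linear g -> linear h -> bilin (fun u v => f (g u) (h v)).
Proof.
case=> fl fr gl hl; split=> [v|u]; first exact: linear_comp (fl (h v)) gl.
exact: linear_comp (fr (g u)) hl.
Qed.

Lemma bilin_post U V W W' (f : U -> V -> W) (h : W -> W') :
  bilin f -> linear h -> bilin (fun u v => h (f u v)).
Proof. by case=> fl fr hl; split=> [v|u]; apply: linear_comp. Qed.

Lemma linear_tlift U V W W' (f : U -> V -> W) (h : W -> W') x :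
  bilin f -> linear h -> h (tlift f x) = tlift (fun u v => h (f u v)) x.
Proof.
move=> fb hl; have hfb := bilin_post fb hl; move: x; apply: tens_eq => [||u v].
- exact: linear_comp hl (tlift_linear fb).
- exact: tlift_linear.
- by rewrite !tlift_pure.
Qed.

Section TensorMaps.
Variables (U V U' V' : lmodType K) (f : U -> U') (g : V -> V').
Hypotheses (fl : linear f) (gl : linear g).

Lemma tmap_bilin : bilin (fun u v => f u \ox g v).
Proof. exact: bilin_comp (tpure_bilin _ _) fl gl. Qed.

Lemma tmap_linear : linear (tmap f g).
Proof. exact: tlift_linear tmap_bilin. Qed.

Lemma tmap_pure u v : tmap f g (u \ox v) = f u \ox g v.
Proof. exact: tlift_pure tmap_bilin u v. Qed.

End TensorMaps.

Lemma tmap_comp U V U' V' U'' V'' (f' : U' -> U'') (g' : V' -> V'')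
    (f : U -> U') (g : V -> V') x :
  linear f' -> linear g' -> linear f -> linear g ->
  tmap f' g' (tmap f g x) = tmap (fun u => f' (f u)) (fun v => g' (g v)) x.
Proof.
move=> f'l g'l fl gl; have f'fl := linear_comp f'l fl.
have g'gl := linear_comp g'l gl.
move: x; apply: tens_eq => [||u v].
- exact: linear_comp (tmap_linear _ _) (tmap_linear _ _).
- exact: tmap_linear.
- by rewrite !tmap_pure.
Qed.

Lemma eq_tmap U V U' V' (f f' : U -> U') (g g' : V -> V') :
  f =1 f' -> g =1 g' -> tmap f g =1 tmap f' g'.
Proof. by move=> /funext-> /funext->. Qed.

Lemma tflip_bilin U V : bilin (fun (u : U) (v : V) => v \ox u).
Proof. by split=> [v|u]; [exact: tpurer|exact: tpurel]. Qed.

Lemma tflip_pure U V (u : U) (v : V) : tflip (u \ox v) = v \ox u.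
Proof. exact: tlift_pure (tflip_bilin U V) u v. Qed.

Lemma tflip_linear U V : linear (@tflip K U V).
Proof. exact: tlift_linear (tflip_bilin U V). Qed.

Lemma tflipK U V : cancel (@tflip K U V) (@tflip K V U).
Proof.
apply: tens_eq => [||u v]; last by rewrite !tflip_pure.
  exact: linear_comp (@tflip_linear _ _) (@tflip_linear _ _).
exact: linear_id_fun.
Qed.

Lemma tflip_tmap U V U' V' (f : U -> U') (g : V -> V') x :
  linear f -> linear g -> tflip (tmap f g x) = tmap g f (tflip x).
Proof.
move=> fl gl; move: x; apply: tens_eq => [||u v].
- exact: linear_comp (@tflip_linear _ _) (tmap_linear fl gl).
- exact: linear_comp (tmap_linear gl fl) (@tflip_linear _ _).
- by rewrite tmap_pure // !tflip_pure tmap_pure.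
Qed.

Section Associativity.
Variables U V W : lmodType K.

Lemma tassoc_bilin :
  bilin (fun (uv : tens U V) (w : W) => tlift (fun u v => u \ox (v \ox w)) uv).
Proof.
split=> [w|uv k x y].
  exact/tlift_linear/(bilin_comp (tpure_bilin _ _) (@linear_id_fun _ _) (tpurel w)).
by apply: (tlift_linear_param (f := fun w u v => u \ox (v \ox w))) => u v;
  rewrite !tpurer.
Qed.

Lemma tassoc_linear : linear (@tassoc K U V W).
Proof. exact: tlift_linear tassoc_bilin. Qed.

Lemma tassoc_pure (u : U) (v : V) (w : W) :
  tassoc (u \ox v \ox w) = u \ox (v \ox w).
Proof.
rewrite /tassoc (tlift_pure tassoc_bilin) tlift_pure //.
exact: bilin_comp (tpure_bilin _ _) (@linear_id_fun _ _) (tpurel w).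
Qed.

Lemma tassoc_inv_bilin :
  bilin (fun (u : U) (vw : tens V W) => tlift (fun v w => u \ox v \ox w) vw).
Proof.
split=> [vw k x y|u].
  by apply: (tlift_linear_param (f := fun u v w => u \ox v \ox w)) => v w;
    rewrite !tpurel.
exact/tlift_linear/(bilin_comp (tpure_bilin _ _) (tpurer u) (@linear_id_fun _ _)).
Qed.

Lemma tassoc_inv_linear : linear (@tassoc_inv K U V W).
Proof. exact: tlift_linear tassoc_inv_bilin. Qed.

Lemma tassoc_inv_pure (u : U) (v : V) (w : W) :
  tassoc_inv (u \ox (v \ox w)) = u \ox v \ox w.
Proof.
rewrite /tassoc_inv (tlift_pure tassoc_inv_bilin) tlift_pure //.
exact: bilin_comp (tpure_bilin _ _) (tpurer u) (@linear_id_fun _ _).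
Qed.

Lemma tens3_eq (X : lmodType K) (f g : tens U (tens V W) -> X) : linear f -> linear g ->
  (forall u v w, f (u \ox (v \ox w)) = g (u \ox (v \ox w))) -> f =1 g.
Proof.
move=> fl gl fg; apply: tens_eq => // u; apply: tens_eq => [||v w //].
  exact: linear_comp fl (tpurer u).
exact: linear_comp gl (tpurer u).
Qed.

Lemma tens3_eql (X : lmodType K) (f g : tens (tens U V) W -> X) : linear f -> linear g ->
  (forall u v w, f (u \ox v \ox w) = g (u \ox v \ox w)) -> f =1 g.
Proof.
move=> fl gl fg; apply: tens_eq => // uv w; move: uv.
apply: tens_eq => [||u v //].
  exact: linear_comp fl (tpurel w).
exact: linear_comp gl (tpurel w).
Qed.

End Associativity.

Lemma tassoc_tmap U V W U' V' W' (f : U -> U') (g : V -> V') (h : W -> W') x :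
  linear f -> linear g -> linear h ->
  tassoc (tmap (tmap f g) h x) = tmap f (tmap g h) (tassoc x).
Proof.
move=> fl gl hl; have fgl := tmap_linear fl gl; have ghl := tmap_linear gl hl.
move: x; apply: tens3_eql => [||u v w].
- exact: linear_comp (@tassoc_linear _ _ _) (tmap_linear fgl hl).
- exact: linear_comp (tmap_linear fl ghl) (@tassoc_linear _ _ _).
- by rewrite tassoc_pure !tmap_pure // tassoc_pure.
Qed.

End LinearMaps.

(** * Contraction by a form on a coalgebra *)

Section Contraction.
Variables (K : comPzRingType) (M : coalgebra K) (v : {scalar tens M M}).
Implicit Types al be ga : M.

Let Dl : linear (co_mul M) := linearP (co_mul M).

Lemma form_bilin (U W : lmodType K) (f : U -> W) al :
  linear f -> bilin (fun (mu : M) nu => v (al \ox mu) *: f nu).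
Proof.
move=> fl; split=> [nu k x y|mu].
  by rewrite (tpurer al) linearP scalerDl -scalerA.
exact: linear_scale_fun.
Qed.

(** All brackets below see the form [v] only through this map, which is
[v (al (x) be2) be1 (x) be3] in Sweedler notation.  Using it in place of iterated
coproducts reduces the coalgebra computations to two identities,
[contract_coassoc] and [contract_flip]. *)
Definition contract (al be : M) : tens M M := form_hat v (al \ox be).

Definition contractr (al be : M) : M :=
  tlift (fun mu nu => v (al \ox mu) *: nu) (co_mul M be).

Definition contractl (al be : M) : M :=
  tlift (fun mu nu => v (al \ox nu) *: mu) (co_mul M be).

Lemma contractr_bilinr al : bilin (fun mu nu : M => v (al \ox mu) *: nu).
Proof. exact: form_bilin (@linear_id_fun _ _). Qed.

Lemma contractl_bilinr al : bilin (fun mu nu : M => v (al \ox nu) *: mu).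
Proof.
have [l r] := form_bilin al (@linear_id_fun _ M).
by split=> [x|x]; [exact: r|exact: l].
Qed.

Lemma contractr_linear al : linear (contractr al).
Proof. exact: linear_comp (tlift_linear (contractr_bilinr al)) Dl. Qed.

Lemma contractl_linear al : linear (contractl al).
Proof. exact: linear_comp (tlift_linear (contractl_bilinr al)) Dl. Qed.

Let f3 al (m1 m2 m3 : M) : tens M M := v (al \ox m2) *: (m1 \ox m3).

Let f3_trilin al : trilin (f3 al).
Proof.
split=> [m1|m2 m3]; first exact: form_bilin (tpurer m1).
exact: linear_scale_fun (tpurel m3).
Qed.

Let contract_sweedler al be : contract al be = sweedler3 (f3 al) be.
Proof.
rewrite /contract /form_hat tlift_pure //; split=> [{}be k x y|{}al].
  apply: (tlift_linear_param (f := fun al m1 => tlift (f3 al m1))) => m1 z.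
  apply: (tlift_linear_param (f := fun al => f3 al m1)) => m2 m3.
  by rewrite /f3 (tpurel m2) linearP scalerDl -scalerA.
apply: linear_comp (tlift3_linear (f3_trilin al)) _.
exact: linear_comp (tmap_linear (@linear_id_fun _ _) Dl) Dl.
Qed.

Lemma tlift_contract (W : lmodType K) (h : M -> M -> W) al be : bilin h ->
  tlift h (contract al be) =
  sweedler3 (fun m1 m2 m3 => v (al \ox m2) *: h m1 m3) be.
Proof.
move=> hb; rewrite contract_sweedler /sweedler3.
have ht : trilin (fun m1 m2 m3 : M => v (al \ox m2) *: h m1 m3).
  case: hb => hl hr; split=> [m1|m2 m3]; first exact: form_bilin.
  exact: linear_scale_fun.
move: (tmap _ _ _); apply: tens3_eq => [||m1 m2 m3].
- exact: linear_comp (tlift_linear hb) (tlift3_linear (f3_trilin al)).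
- exact: tlift3_linear.
rewrite (tlift3_pure _ _ _ (f3_trilin al)) (tlift3_pure _ _ _ ht).
by rewrite (linear_funZ _ _ (tlift_linear hb)) tlift_pure.
Qed.

(** The middle leg of the iterated coproduct can be split off from the right factor,
as here, or, by coassociativity, from the left one, as in [contract_l]; an
antiautomorphism of [M] exchanges the two. *)
Lemma contract_r al be :
  contract al be = tmap id (contractr al) (co_mul M be).
Proof.
rewrite contract_sweedler /sweedler3; move: (co_mul M be).
apply: tens_eq => [||m1 z].
- apply: linear_comp (tlift3_linear (f3_trilin al)) _.
  exact: tmap_linear (@linear_id_fun _ _) Dl.
- exact: tmap_linear (@linear_id_fun _ _) (contractr_linear al).
rewrite !tmap_pure //; try exact: contractr_linear; try exact: Dl.
rewrite /tlift3 tlift_pure; last exact: tlift3_bilin (f3_trilin al).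
rewrite /contractr (linear_tlift _ (contractr_bilinr al) (tpurer m1)).
by congr tlift; do 2!apply/funext => ?; rewrite (linear_funZ _ _ (tpurer m1)).
Qed.

Lemma contract_l al be :
  contract al be = tmap (contractl al) id (co_mul M be).
Proof.
rewrite contract_sweedler /sweedler3 -co_mulA; move: (co_mul M be).
have tl := tlift3_linear (f3_trilin al).
apply: tens_eq => [||z m3].
- apply: linear_comp tl _; apply: linear_comp (@tassoc_linear _ _ _ _) _.
  exact: tmap_linear Dl (@linear_id_fun _ _).
- exact: tmap_linear (contractl_linear al) (@linear_id_fun _ _).
rewrite !tmap_pure //; try exact: contractl_linear; try exact: Dl.
rewrite /contractl; move: (co_mul M z); apply: tens_eq => [||m1 m2].
- apply: linear_comp tl _; apply: linear_comp (@tassoc_linear _ _ _ _) _.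
  exact: tpurel.
- exact: linear_comp (tpurel m3) (tlift_linear (contractl_bilinr al)).
rewrite tassoc_pure (tlift3_pure _ _ _ (f3_trilin al)).
rewrite (tlift_pure (contractl_bilinr al)).
by rewrite (linear_funZ _ _ (tpurel m3)).
Qed.

Lemma contract_linear al : linear (contract al).
Proof.
rewrite (funext (contract_r al)); apply: linear_comp Dl.
exact: tmap_linear (@linear_id_fun _ _) (contractr_linear al).
Qed.

(** Coassociativity, with the form applied to the first leg. *)
Lemma contractr_comul al be :
  co_mul M (contractr al be) = tmap (contractr al) id (co_mul M be).
Proof.
pose h (mu : M) (z : tens M M) := v (al \ox mu) *: z.
have hb : bilin h by apply: form_bilin (@linear_id_fun _ _).
transitivity (tlift h (tmap id (co_mul M) (co_mul M be))).
  rewrite /contractr (linear_tlift _ (contractr_bilinr al) Dl).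
  have hDb : bilin (fun mu nu : M => co_mul M (v (al \ox mu) *: nu)).
    exact: bilin_post (contractr_bilinr al) Dl.
  move: (co_mul M be); apply: tens_eq => [||mu nu].
  - exact: tlift_linear.
  - apply: linear_comp (tlift_linear hb) _.
    exact: tmap_linear (@linear_id_fun _ _) Dl.
  rewrite tmap_pure //; try exact: Dl.
  by rewrite !tlift_pure // (linear_funZ _ _ Dl).
rewrite -co_mulA; move: (co_mul M be); apply: tens_eq => [||z nu].
- apply: linear_comp (tlift_linear hb) _.
  apply: linear_comp (@tassoc_linear _ _ _ _) _.
  exact: tmap_linear Dl (@linear_id_fun _ _).
- exact: tmap_linear (contractr_linear al) (@linear_id_fun _ _).
rewrite !tmap_pure //; try exact: contractr_linear; try exact: Dl.
rewrite /contractr; move: (co_mul M z); apply: tens_eq => [||m1 m2].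
- apply: linear_comp (tlift_linear hb) _.
  exact: linear_comp (@tassoc_linear _ _ _ _) (tpurel nu).
- exact: linear_comp (tpurel nu) (tlift_linear (contractr_bilinr al)).
rewrite tassoc_pure (tlift_pure hb) (tlift_pure (contractr_bilinr al)).
by rewrite (linear_funZ _ _ (tpurel nu)).
Qed.

(** Both sides are [v (al (x) ga2) v (be (x) ga4) ga1 (x) ga3 (x) ga5]. *)
Lemma contract_coassoc al be ga :
  tmap id (contract be) (contract al ga) =
  tassoc (tmap (contract al) id (contract be ga)).
Proof.
have idl := @linear_id_fun _ M; have rl := contractr_linear.
have idr a := tmap_linear idl (rl a).
rewrite (contract_r al ga) tmap_comp //; last exact: contract_linear.
have -> : (fun m : M => contract be (contractr al m)) =
    fun m => tmap (contractr al) (contractr be) (co_mul M m).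
  by apply/funext => m; rewrite contract_r contractr_comul tmap_comp.
have rrl := tmap_linear (rl al) (rl be).
rewrite -(tmap_comp (f' := id) _ idl rrl idl Dl) -co_mulA.
rewrite -tassoc_tmap //; congr tassoc.
rewrite contract_r !tmap_comp //; try exact: contract_linear; try exact: Dl.
by apply: eq_tmap => // m; apply/esym/contract_r.
Qed.

Hypothesis v_cyclic : cyclic_form v.

Lemma contract_flip al be : contract be al = tflip (contract al be).
Proof. by have := v_cyclic (al \ox be); rewrite tflip_pure. Qed.

(** Coassociativity and cyclicity combined: rotating the three arguments rotates the
three tensor factors.  This matches the rotation of the arguments in the double
Jacobi identity. *)
Lemma contract_rot al be ga :
  tassoc (tmap (contract be) id (contract ga al)) =
  tassoc (tflip (tassoc (tmap (contract al) id (contract be ga)))).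
Proof.
rewrite -(contract_coassoc al be ga) (contract_flip al ga) tflip_tmap //.
exact: contract_linear.
Qed.

End Contraction.

(** * Evaluating tensors in a graded algebra *)

Section GradedAlgebraTheory.
Variables (K : comPzRingType) (B : gradedAlg K).

Lemma gmul_linearl (y : B) : linear (fun x : B => x \m y).
Proof. by case: (ga_mul_bilin B). Qed.
Lemma gmul_linearr (x : B) : linear (fun y : B => x \m y).
Proof. by case: (ga_mul_bilin B). Qed.
Lemma gmulDl (x y z : B) : (x + y) \m z = x \m z + y \m z.
Proof. exact: linear_funD (gmul_linearl z). Qed.
Lemma gmulDr (x y z : B) : z \m (x + y) = z \m x + z \m y.
Proof. exact: linear_funD (gmul_linearr z). Qed.
Lemma gmulZl k (x z : B) : (k *: x) \m z = k *: (x \m z).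
Proof. exact: linear_funZ (gmul_linearl z). Qed.
Lemma gmulZr k (x z : B) : z \m (k *: x) = k *: (z \m x).
Proof. exact: linear_funZ (gmul_linearr z). Qed.
Lemma gmul0l (z : B) : 0 \m z = 0.
Proof. exact: linear_fun0 (gmul_linearl z). Qed.
Lemma gmul0r (z : B) : z \m 0 = 0.
Proof. exact: linear_fun0 (gmul_linearr z). Qed.

Lemma tens_eq_hom (W : lmodType K) (f g : tens B B -> W) :
  linear f -> linear g ->
  (forall p q a b, ga_hom p a -> ga_hom q b -> f (a \ox b) = g (a \ox b)) ->
  f =1 g.
Proof.
move=> fl gl fg; apply: tens_eq => // a b.
move: a; apply: eq_linear_hom => [||p a ha].
- exact: linear_comp fl (tpurel b).
- exact: linear_comp gl (tpurel b).
move: b; apply: eq_linear_hom => [||q b hb].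
- exact: linear_comp fl (tpurer a).
- exact: linear_comp gl (tpurer a).
exact: fg ha hb.
Qed.

Definition tpair (U V M N : lmodType K) (f : U -> M -> B) (g : V -> N -> B)
    (x : tens U V) (y : tens M N) : B :=
  tlift (fun u v => tlift (fun m n => f u m \m g v n) y) x.

Section Pairing.
Variables (U V M N : lmodType K) (f : U -> M -> B) (g : V -> N -> B).
Hypotheses (fb : bilin f) (gb : bilin g).

Let inner_bilin u v : bilin (fun m n => f u m \m g v n).
Proof. by apply: bilin_comp (ga_mul_bilin B) _ _; [case: fb|case: gb]. Qed.

Let outer_bilin y : bilin (fun u v => tlift (fun m n => f u m \m g v n) y).
Proof.
split=> [v k u u'|u k v v'].
  apply: (tlift_linear_param (f := fun u m n => f u m \m g v n)) => m n.
  by case: fb => fl _; rewrite fl gmul_linearl.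
apply: (tlift_linear_param (f := fun v m n => f u m \m g v n)) => m n.
by case: gb => gl _; rewrite gl gmul_linearr.
Qed.

Lemma tpair_bilin : bilin (tpair f g).
Proof.
split=> [y|x k y y']; first exact: tlift_linear (outer_bilin y).
apply: (tlift_linear_param
  (f := fun y u v => tlift (fun m n => f u m \m g v n) y)) => u v.
exact: tlift_linear (inner_bilin u v) _ _ _.
Qed.

Lemma tpair_pure u v m n : tpair f g (u \ox v) (m \ox n) = f u m \m g v n.
Proof.
rewrite /tpair (tlift_pure (outer_bilin _)).
exact: tlift_pure (inner_bilin u v) m n.
Qed.

End Pairing.

Lemma tpair_assoc (U V W M N O : lmodType K) (f : U -> M -> B) (g : V -> N -> B)
    (h : W -> O -> B) x y : bilin f -> bilin g -> bilin h ->
  tpair f (tpair g h) (tassoc x) (tassoc y) = tpair (tpair f g) h x y.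
Proof.
move=> fb gb hb; have fgb := tpair_bilin fb gb; have ghb := tpair_bilin gb hb.
have [l1 r1] := tpair_bilin fb ghb; have [l2 r2] := tpair_bilin fgb hb.
move: y; apply: tens3_eql => [||m n o].
- exact: linear_comp (r1 _) (@tassoc_linear _ _ _ _).
- exact: r2.
move: x; apply: tens3_eql => [||u v w].
- exact: linear_comp (l1 _) (@tassoc_linear _ _ _ _).
- exact: l2.
by rewrite !tassoc_pure !tpair_pure // ga_mulA.
Qed.

End GradedAlgebraTheory.

(** * The algebra of representations *)

Section RepresentationAlgebraTheory.
Variables (K : comPzRingType) (A : gradedAlg K) (M : coalgebra K).
Notation AM := (repAlg A M).
Implicit Types (a b c : A) (al be : M) (p q r : int).

Lemma rgen_hom p a al : ga_hom p a -> ga_hom p (rgen a al : AM).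
Proof. exact: rep_hom_gen. Qed.

Lemma rgen_prod a b al (s : seq (M * M)) :
  co_mul M al = \sum_(m <- s) m.1 \ox m.2 ->
  rgen (a \m b) al = \sum_(m <- s) rgen a m.1 \m rgen b m.2 :> AM.
Proof. exact: rep_gen0_prod. Qed.

(** Homogeneous elements are obtained from homogeneous generators without leaving the
homogeneous elements.  Statements with signs are proved along this induction. *)
Lemma rep_homP (P : int -> AM -> Prop) :
  (forall p a al, ga_hom p a -> P p (rgen a al)) -> (forall p, P p 0) ->
  (forall p x y, P p x -> P p y -> P p (x + y)) ->
  (forall p k x, P p x -> P p (k *: x)) ->
  (forall p q x y, ga_hom p x -> ga_hom q y -> P p x -> P q y ->
    P (p + q) (x \m y)) ->
  forall p x, ga_hom p x -> P p x.
Proof.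
move=> Pg P0 PD PZ PM p x; elim=> {p x} [p a al|p|p x y _ IHx _|p k x _|
  p q x y hx IHx hy] //.
- exact: Pg.
- exact: PD.
- exact: PZ.
- exact: PM.
Qed.

(** The defining relations impose graded commutativity on generators; it spreads to
products in either argument. *)
Lemma rep_comm p q (x y : AM) : ga_hom p x -> ga_hom q y ->
  x \m y = sgnz (p * q) *: (y \m x).
Proof.
move=> hx; move: p x hx q y.
apply: rep_homP => [p a al ha|p|p x y IHx IHy|p k x IHx|p q x y _ _ IHx IHy].
- apply: rep_homP => [q b be hb|q|q x y IHx IHy|q k x IHx|q r x y _ _ IHx IHy].
  + exact: rep_gen0_comm.
  + by rewrite gmul0l gmul0r scaler0.
  + by rewrite gmulDl gmulDr scalerDr IHx IHy.
  + by rewrite gmulZl gmulZr IHx !scalerA mulrC.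
  rewrite ga_mulA IHx gmulZl -ga_mulA IHy gmulZr scalerA -sgnzD -mulrDr.
  by rewrite ga_mulA.
- by move=> q y _; rewrite gmul0l gmul0r scaler0.
- by move=> q z hz; rewrite gmulDl gmulDr scalerDr (IHx _ _ hz) (IHy _ _ hz).
- by move=> q z hz; rewrite gmulZl gmulZr (IHx _ _ hz) !scalerA mulrC.
move=> r z hz; rewrite -ga_mulA (IHy _ _ hz) gmulZr ga_mulA (IHx _ _ hz).
by rewrite gmulZl scalerA -sgnzD -mulrDl addrC ga_mulA.
Qed.

Lemma rgen_bilinear : bilin (@rgen K A M).
Proof. exact: rep_gen0_bilin. Qed.
Let gb := rgen_bilinear.

(** In the notation of generators, [x1_y1 x2_y2] and [x1_y1 x2_y2 x3_y3]. *)
Definition ev2 : tens A A -> tens M M -> AM := tpair (@rgen K A M) (@rgen K A M).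
Definition ev3 : tens A (tens A A) -> tens M (tens M M) -> AM :=
  tpair (@rgen K A M) ev2.

Lemma ev2_bilin : bilin ev2.
Proof. exact: tpair_bilin gb gb. Qed.
Lemma ev2_pure a b al be : ev2 (a \ox b) (al \ox be) = rgen a al \m rgen b be.
Proof. exact: tpair_pure. Qed.
Lemma ev3_bilin : bilin ev3.
Proof. exact: tpair_bilin gb ev2_bilin. Qed.
Lemma ev3_pure a b c al be ga : ev3 (a \ox (b \ox c)) (al \ox (be \ox ga)) =
  rgen a al \m (rgen b be \m rgen c ga).
Proof. by rewrite /ev3 tpair_pure ?ev2_pure //; apply: ev2_bilin. Qed.

(** Flips of the two tensors compensate each other, the Koszul sign of [P21] being
the one that commutes the factors in [A_M]. *)
Lemma ev2_flip x y : ev2 (P21 0 x) (tflip y) = ev2 x y.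
Proof.
have [l r] := ev2_bilin; move: y; apply: tens_eq => [||al be].
- exact: linear_comp (r _) (@tflip_linear _ _ _).
- exact: r.
move: x; apply: tens_eq_hom => [||p q a b ha hb].
- exact: linear_comp (l _) (@P21_linear _ _ _).
- exact: l.
rewrite (P21E _ ha hb) !addr0 tflip_pure (linear_funZ _ _ (l _)) !ev2_pure.
exact/esym/(rep_comm (rgen_hom al ha) (rgen_hom be hb)).
Qed.

Lemma ev3_rot x y : ev3 (P312 0 x) y = ev3 x (tassoc (tflip y)).
Proof.
have [l r] := ev3_bilin; move: y; apply: tens3_eq => [||al be ga].
- exact: r.
- apply: linear_comp (r _) _.
  exact: linear_comp (@tassoc_linear _ _ _ _) (@tflip_linear _ _ _).
rewrite tflip_pure tassoc_pure.
elim/tens3_hom_ind: x => [|x y IHx IHy|k x IHx|p q s a b c ha hb hc].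
- by rewrite (linear_fun0 (@P312_linear _ _ _)) !(linear_fun0 (l _)).
- by rewrite (linear_funD _ _ (@P312_linear _ _ _)) !(linear_funD _ _ (l _)) IHx IHy.
- by rewrite (linear_funZ _ _ (@P312_linear _ _ _)) !(linear_funZ _ _ (l _)) IHx.
rewrite (P312E _ ha hb hc) !addr0 (linear_funZ _ _ (l _)) !ev3_pure -mulrDl.
rewrite [RHS]ga_mulA; apply/esym/rep_comm; last exact: rgen_hom.
exact: ga_hom_mul (rgen_hom be ha) (rgen_hom ga hb).
Qed.

End RepresentationAlgebraTheory.

(** * The Jacobi identity for a biderivation *)

(** The additive skeleton of the computation that a commutator of derivations is a
derivation: the mixed terms [b1] and [b2] cancel. *)
Lemma derivation_cancel (V : zmodType) (a1 a2 a3 a4 a5 a6 b1 b2 : V) :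
  a1 + b1 + (b2 + a2) - (a3 + a4) - (a5 + b2 + (b1 + a6)) =
  a1 - a3 - a5 + (a2 - a4 - a6).
Proof.
rewrite !opprD.
rewrite [LHS](AC (2*2*2*(2*2)) ((2*9)*(3*8)*((1*5*7)*(4*6*10)))).
by rewrite /= !subrr !add0r.
Qed.

Section Jacobiator.
Variables (K : comPzRingType) (B : gradedAlg K) (n : int) (br : B -> B -> B).
Hypothesis br_bider : biderivation n br.
Implicit Types (p q r : int) (x y z : B).

Lemma bider_linearr x : linear (br x).
Proof. by case: (bd_bilin br_bider). Qed.

Definition jacobiator p q r x y z : B :=
  sgnz ((p + n) * (r + n)) *: br x (br y z) +
  sgnz ((q + n) * (p + n)) *: br y (br z x) +
  sgnz ((r + n) * (q + n)) *: br z (br x y).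

Lemma jacobiator_rot p q r x y z :
  jacobiator p q r x y z = jacobiator q r p y z x.
Proof. by rewrite [RHS]addrC addrA. Qed.

(** The failure of [br x] to be a graded derivation of the bracket.  As the difference
of a commutator of derivations and of the derivation [br (br x y)], it is easier to
handle than the cyclic sum. *)
Definition loday p q x y z : B :=
  br x (br y z) - br (br x y) z - sgnz ((p + n) * (q + n)) *: br y (br x z).

Lemma jacobiator_loday p q r x y z :
  ga_hom p x -> ga_hom q y -> ga_hom r z ->
  jacobiator p q r x y z = sgnz ((p + n) * (r + n)) *: loday p q x y z.
Proof.
move=> hx hy hz; rewrite /jacobiator /loday.
rewrite (bd_antisym br_bider hz hx) (linear_funN _ (bider_linearr y)).
rewrite (linear_funZ _ _ (bider_linearr y)).
rewrite (bd_antisym br_bider hz (bd_degree br_bider hx hy)).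
rewrite !scalerBr !scalerN !scalerA [LHS]addrAC -!sgnzD.
by congr (_ - _ - _); congr (_ *: _); by_parity.
Qed.

Lemma loday_linear p q x y : linear (loday p q x y).
Proof.
move=> k z z'; rewrite /loday !(bider_linearr x, bider_linearr y).
rewrite (bider_linearr (br x y)) !scalerDr !scalerN !opprD !scalerA.
by rewrite [_ * k]mulrC (AC (2*2*2) ((1*3*5)*(2*4*6))) /=.
Qed.

Lemma loday_mul p q r s x y u w :
  ga_hom p x -> ga_hom q y -> ga_hom r u -> ga_hom s w ->
  loday p q x y (u \m w) = loday p q x y u \m w +
    sgnz ((p + q) * r) *: (u \m loday p q x y w).
Proof.
move=> hx hy hu hw; rewrite /loday.
have hxy := bd_degree br_bider hx hy.
have [hyu hyw] := (bd_degree br_bider hy hu, bd_degree br_bider hy hw).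
have [hxu hxw] := (bd_degree br_bider hx hu, bd_degree br_bider hx hw).
rewrite (bd_leibnizr br_bider hxy hu hw).
rewrite (bd_leibnizr br_bider hy hu hw) (bd_leibnizr br_bider hx hu hw).
rewrite (linear_funD _ _ (bider_linearr x)) (linear_funZ _ _ (bider_linearr x)).
rewrite (linear_funD _ _ (bider_linearr y)) (linear_funZ _ _ (bider_linearr y)).
rewrite (bd_leibnizr br_bider hx hyu hw) (bd_leibnizr br_bider hx hu hyw).
rewrite (bd_leibnizr br_bider hy hxu hw) (bd_leibnizr br_bider hy hu hxw).
rewrite -!scaleN1r !(gmulDl, gmulDr) !(gmulZl, gmulZr) !scaleN1r.
rewrite !scalerDr !scalerN !scalerA -!sgnzD.
rewrite -(derivation_cancel _ _ _ _ _ _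
  (sgnz ((p + n) * (q + r + n)) *: (br y u \m br x w))
  (sgnz ((q + n) * r) *: (br x u \m br y w))).
congr (_ + _ + (_ + _) - (_ + _) - (_ + _ + (_ + _)));
  congr (_ *: _); by by_parity.
Qed.

End Jacobiator.

Section RepJacobi.
Variables (K : comPzRingType) (A : gradedAlg K) (M : coalgebra K) (n : int).
Notation AM := (repAlg A M).
Variable br : AM -> AM -> AM.
Hypothesis br_bider : biderivation n br.

(** In its last argument the Jacobiator is, up to a sign, a derivation. *)
Lemma jacobiator_extend p q (x y : AM) : ga_hom p x -> ga_hom q y ->
  (forall r c ga, ga_hom r c -> jacobiator n br p q r x y (rgen c ga) = 0) ->
  forall r z, ga_hom r z -> jacobiator n br p q r x y z = 0.
Proof.
move=> hx hy jac_gen r z hz; rewrite (jacobiator_loday br_bider hx hy hz).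
have ll := loday_linear br_bider p q x y.
suff -> : loday n br p q x y z = 0 by rewrite scaler0.
move: r z hz; apply: rep_homP => [r c ga hc|r|r z z' IHz IHz'|r k z IHz|
  r s u w hu hw IHu IHw].
- have := jac_gen r c ga hc.
  rewrite (jacobiator_loday br_bider hx hy (rgen_hom ga hc)).
  move=> /(congr1 ( *:%R (sgnz ((p + n) * (r + n))))).
  by rewrite scalerA sgnzM scale1r scaler0.
- exact: linear_fun0 ll.
- by rewrite (linear_funD _ _ ll) IHz IHz' addr0.
- by rewrite (linear_funZ _ _ ll) IHz scaler0.
by rewrite (loday_mul br_bider hx hy hu hw) IHu IHw gmul0l gmul0r scaler0 addr0.
Qed.

(** The Jacobiator is invariant under rotation, hence each argument can be moved to
the last place and reduced to a generator there. *)
Lemma gerstenhaber_gen :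
  (forall p q r (a b c : A) (al be ga : M),
    ga_hom p a -> ga_hom q b -> ga_hom r c ->
    jacobiator n br p q r (rgen a al) (rgen b be) (rgen c ga) = 0) ->
  gerstenhaber n br.
Proof.
move=> jac; split=> // p q r x y z hx hy hz.
rewrite -/(jacobiator n br p q r x y z).
apply: jacobiator_extend hz => // {}r c ga hc; have hc' := rgen_hom ga hc.
rewrite jacobiator_rot jacobiator_rot.
apply: jacobiator_extend hy => // {}q b be hb; have hb' := rgen_hom be hb.
rewrite jacobiator_rot jacobiator_rot.
apply: jacobiator_extend hx => // {}p a al ha.
by rewrite jacobiator_rot jacobiator_rot; apply: jac.
Qed.

End RepJacobi.

(** * The Jacobi identity for a derived bracket *)

Section DerivedBracket.
Variables (K : comPzRingType) (A : gradedAlg K) (M : coalgebra K) (n : int).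
Notation AM := (repAlg A M).
Variables (db : {linear tens A A -> tens A A}) (v : {scalar tens M M}).
Variable br : AM -> AM -> AM.
Hypotheses (br_derived : derived_bracket n db v br).
Implicit Types (a b c : A) (al be ga : M) (p q r : int).

Let br_bider : biderivation n br := proj1 br_derived.
Let dbl : linear db := linearP db.

Lemma derived_rgen a b al be :
  br (rgen a al) (rgen b be) = ev2 (db (a \ox b)) (contract v al be).
Proof.
rewrite (proj2 br_derived) /ev2 /tpair; congr tlift.
apply/funext => x; apply/funext => y; rewrite tlift_contract //.
by case: (rgen_bilinear A M) => _ gr; apply: bilin_comp (ga_mul_bilin _) _ _.
Qed.

(** The map [(db (x) id)] on [a (x) z], one half of the composite defining the
tribracket. *)
Definition db_left a (z : tens A A) : tens (tens A A) A :=
  tmap db id (tassoc_inv (a \ox z)).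

Lemma db_left_linear a : linear (db_left a).
Proof.
apply: linear_comp (tmap_linear dbl (@linear_id_fun _ _)) _.
exact: linear_comp (@tassoc_inv_linear _ _ _ _) (tpurer a).
Qed.

(** By the Leibniz rule the generator is bracketed with either factor of [ev2 z y].
When it meets the second factor, commuting the first factor out of the way turns
the result into a term of the first kind for the flipped tensors; all signs are
absorbed in [P21]. *)
Lemma derived_ev2 p a al (z : tens A A) (y : tens M M) : ga_hom p a ->
  br (rgen a al) (ev2 z y) =
    ev3 (tassoc (db_left a z)) (tassoc (tmap (contract v al) id y)) +
    ev3 (tassoc (db_left a (P21 0 z))) (tassoc (tmap (contract v al) id (tflip y))).
Proof.
move=> ha; have idM := @linear_id_fun _ M.
have gb := rgen_bilinear A M; have eb := @ev2_bilin _ A M.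
rewrite /ev3 !tpair_assoc // -/(@ev2 K A M).
have [l r] := tpair_bilin eb gb; have [el er] := eb.
have cl := tmap_linear (contract_linear v al) idM.
have dl := db_left_linear a; have bl := bider_linearr br_bider (rgen a al).
move: y; apply: tens_eq => [||mu nu].
- exact: linear_comp bl (er z).
- apply: linear_add; first exact: linear_comp (r _) cl.
  exact: linear_comp (linear_comp (r _) cl) (@tflip_linear _ _ _).
move: z; apply: tens_eq_hom => [||q s x y hx hy].
- exact: linear_comp bl (el _).
- apply: linear_add; first exact: linear_comp (l _) dl.
  exact: linear_comp (linear_comp (l _) dl) (@P21_linear _ _ _).
have clin := contract_linear v al.
rewrite (P21E _ hx hy) (linear_funZ _ _ dl) (linear_funZ _ _ (l _)) !addr0.
rewrite /db_left !tassoc_inv_pure tflip_pure !tmap_pure // !tpair_pure //.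
rewrite ev2_pure -!derived_rgen.
have [[hA hX] hY] := (rgen_hom al ha, rgen_hom mu hx, rgen_hom nu hy).
rewrite (bd_leibnizr br_bider hA hX hY); congr (_ + _).
have hAY := bd_degree br_bider hA hY.
rewrite (rep_comm hX hAY) !scalerA; congr (_ *: _).
by rewrite -sgnzD; by_parity.
Qed.

Hypotheses (db_double : double_bracket n db) (v_cyclic : cyclic_form v).

(** The part of [br (rgen a al) (br (rgen b be) (rgen c ga))] in which
[rgen a al] is bracketed with the first leg of [db (b \ox c)]. *)
Definition nested_left a al b be c ga : AM :=
  ev3 (tassoc (db_left a (db (b \ox c))))
    (tassoc (tmap (contract v al) id (contract v be ga))).

(** The antisymmetry of the double bracket and the cyclicity of the form turn the
flipped tensors of [derived_ev2] into those with [b] and [c] exchanged. *)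
Lemma derived_nested p q r a b c al be ga :
  ga_hom p a -> ga_hom q b -> ga_hom r c ->
  br (rgen a al) (br (rgen b be) (rgen c ga)) =
    nested_left a al b be c ga -
    sgnz ((q + n) * (r + n)) *: nested_left a al c ga b be.
Proof.
move=> ha hb hc; rewrite derived_rgen (derived_ev2 _ _ _ ha); congr (_ + _).
have [el _] := @ev3_bilin _ A M; have tl := @tassoc_linear _ A A A.
have -> : P21 0 (db (b \ox c)) = - (sgnz ((q + n) * (r + n)) *: db (c \ox b)).
  rewrite -(linear_funZ _ _ dbl) -(P21E _ hb hc) (db_antisym db_double).
  by rewrite opprK.
rewrite -contract_flip //.
rewrite (linear_funN _ (db_left_linear a)) (linear_funN _ tl).
rewrite (linear_funN _ (el _)) (linear_funZ _ _ (db_left_linear a)).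
by rewrite (linear_funZ _ _ tl) (linear_funZ _ _ (el _)).
Qed.

Hypothesis db_jacobi : forall x, tribracket n db x = 0.

(** The double Jacobi identity evaluated in [A_M].  The powers of [P312] move to the
coalgebra side by [ev3_rot], where [contract_rot] undoes them by rotating
the arguments. *)
Lemma nested_left_cyclic p q r a b c al be ga :
  ga_hom p a -> ga_hom q b -> ga_hom r c ->
  sgnz ((p + n) * (r + n)) *: nested_left a al b be c ga +
  sgnz ((q + n) * (p + n)) *: nested_left b be c ga a al +
  sgnz ((r + n) * (q + n)) *: nested_left c ga a al b be = 0.
Proof.
move=> ha hb hc.
have [el _] := @ev3_bilin _ A M; have tl := @tassoc_linear _ A A A.
pose R x := tassoc (tmap db id (tassoc_inv (tmap id db x))).
have Rl : linear R.
  apply: linear_comp tl _; apply: linear_comp (tmap_linear dbl _) _ => //.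
  apply: linear_comp (@tassoc_inv_linear _ _ _ _) _.
  exact: tmap_linear (@linear_id_fun _ _) dbl.
have RE x y z : R (x \ox (y \ox z)) = tassoc (db_left x (db (y \ox z))).
  by rewrite /R (tmap_pure (@linear_id_fun _ _) dbl).
have := db_jacobi (a \ox (b \ox c)).
rewrite /tribracket !big_ord_recl big_ord0 /= addr0 -!/(R _).
rewrite (P231E _ ha hb hc) (linear_funZ _ _ (@P231_linear _ _ _)).
rewrite (P231E _ hb hc ha) !(linear_funZ _ _ Rl) !RE.
rewrite !(linear_funZ _ _ (@P312_linear _ _ _)).
pose y := tassoc (tmap (contract v al) id (contract v be ga)).
move=> /(congr1 (fun x => ev3 x y)).
rewrite (linear_fun0 (el y)) !(linear_funD _ _ (el y)) !(linear_funZ _ _ (el y)).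
rewrite !ev3_rot /y -!contract_rot // -!/(nested_left _ _ _ _ _ _).
move=> /(congr1 ( *:%R (sgnz ((p + n) * (r + n))))).
rewrite scaler0 !scalerDr !scalerA -!sgnzD => <-; rewrite addrA.
by congr (_ + _ + _); congr (_ *: _); by by_parity.
Qed.

(** The six terms given by [derived_nested] form two cyclic sums, for [a, b, c] and
for [a, c, b]. *)
Lemma derived_jacobiator p q r a b c al be ga :
  ga_hom p a -> ga_hom q b -> ga_hom r c ->
  jacobiator n br p q r (rgen a al) (rgen b be) (rgen c ga) = 0.
Proof.
move=> ha hb hc; rewrite /jacobiator.
have J2 := nested_left_cyclic al be ga ha hb hc.
have /(congr1 ( *:%R
  (sgnz ((p + n) * (q + n) + (q + n) * (r + n) + (p + n) * (r + n))))) :=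
  nested_left_cyclic al ga be ha hc hb.
rewrite scaler0 !scalerDr !scalerA -!sgnzD => J1.
rewrite !(derived_nested _ _ _ ha hb hc, derived_nested _ _ _ hb hc ha,
  derived_nested _ _ _ hc ha hb).
rewrite !scalerBr !scalerA -!sgnzD.
(* The first cyclic sum is J2; the second is the negative of the left side of J1. *)
rewrite [LHS](AC (2*2*2) ((1*3*5)*(2*6*4))) /=.
rewrite J2 add0r -!opprD -[RHS]oppr0 -J1.
by congr (- (_ + _ + _)); congr (_ *: _); by by_parity.
Qed.

Lemma derived_gerstenhaber : gerstenhaber n br.
Proof.
apply: gerstenhaber_gen => // p q r a b c al be ga.
exact: derived_jacobiator.
Qed.

End DerivedBracket.

(** * Biderivations along homomorphisms *)

Section BiderivationsAlong.
Variables (K : comPzRingType) (n : int).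

(** The common form of the maps obtained from a biderivation by composing it with
algebra homomorphisms, before or after.  Rigidity ([bider_along_rgen]) and
vanishing on ideals ([bider_along_ideal]) hold at this level. *)
Record bider_along (B C : gradedAlg K) (phi : B -> C) (F : B -> B -> C) : Prop :=
  BiderAlong {
  ba_bilin : bilin F;
  ba_leibnizr : forall p q r a b c,
    ga_hom p a -> ga_hom q b -> ga_hom r c ->
    F a (b \m c) = F a b \m phi c + sgnz ((p + n) * q) *: (phi b \m F a c);
  ba_leibnizl : forall p q r a b c,
    ga_hom p a -> ga_hom q b -> ga_hom r c ->
    F (a \m b) c = phi a \m F b c + sgnz (q * (r + n)) *: (F a c \m phi b) }.

Lemma bider_along_post (B C : gradedAlg K) (br : B -> B -> B) (phi : B -> C) :
  linear phi -> (forall x y, phi (x \m y) = phi x \m phi y) ->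
  biderivation n br -> bider_along phi (fun x y => phi (br x y)).
Proof.
move=> phil phiM [bb _ br_r br_l _]; split; first exact: bilin_post.
- move=> p q r a b c ha hb hc.
  by rewrite (br_r _ _ _ _ _ _ ha hb hc) linear_funD // linear_funZ // !phiM.
move=> p q r a b c ha hb hc.
by rewrite (br_l _ _ _ _ _ _ ha hb hc) linear_funD // linear_funZ // !phiM.
Qed.

Lemma bider_along_pre (B C : gradedAlg K) (br : C -> C -> C) (phi : B -> C) :
  linear phi -> (forall x y, phi (x \m y) = phi x \m phi y) ->
  (forall p x, ga_hom p x -> ga_hom p (phi x)) ->
  biderivation n br -> bider_along phi (fun x y => br (phi x) (phi y)).
Proof.
move=> phil phiM phih [bb _ br_r br_l _]; split; first exact: bilin_comp.
- move=> p q r a b c ha hb hc; rewrite phiM.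
  by rewrite (br_r _ _ _ _ _ _ (phih _ _ ha) (phih _ _ hb) (phih _ _ hc)).
move=> p q r a b c ha hb hc; rewrite phiM.
by rewrite (br_l _ _ _ _ _ _ (phih _ _ ha) (phih _ _ hb) (phih _ _ hc)).
Qed.

Lemma bider_along_rgen (A : gradedAlg K) (M : coalgebra K) (C : gradedAlg K)
    (phi : repAlg A M -> C) F F' :
  bider_along phi F -> bider_along phi F' ->
  (forall a b al be, F (rgen a al) (rgen b be) = F' (rgen a al) (rgen b be)) ->
  forall x y, F x y = F' x y.
Proof.
move=> [[Fl Fr] FLr FLl] [[Fl' Fr'] FLr' FLl'] FF' x y.
move: x; apply: eq_linear_hom => // p x hx.
move: y; apply: eq_linear_hom => // q y hy.
move: p x hx q y hy.
apply: rep_homP => [p a al ha|p|p x x' IHx IHx'|p k x IHx|p p' x x' hx hx' IHx IHx'].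
- apply: rep_homP => [q b be hb|q|q y y' IHy IHy'|q k y IHy|q q' y y' hy hy' IHy IHy'].
  + exact: FF'.
  + by rewrite !linear_fun0.
  + by rewrite !linear_funD // IHy IHy'.
  + by rewrite !linear_funZ // IHy.
  have ha' := rgen_hom al ha.
  by rewrite (FLr _ _ _ _ _ _ ha' hy hy') (FLr' _ _ _ _ _ _ ha' hy hy') IHy IHy'.
- by move=> q y _; rewrite (linear_fun0 (Fl y)) (linear_fun0 (Fl' y)).
- move=> q y hy; rewrite (linear_funD _ _ (Fl y)) (linear_funD _ _ (Fl' y)).
  by rewrite (IHx _ _ hy) (IHx' _ _ hy).
- move=> q y hy; rewrite (linear_funZ _ _ (Fl y)) (linear_funZ _ _ (Fl' y)).
  by rewrite (IHx _ _ hy).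
move=> q y hy.
rewrite (FLl _ _ _ _ _ _ hx hx' hy) (FLl' _ _ _ _ _ _ hx hx' hy).
by rewrite (IHx _ _ hy) (IHx' _ _ hy).
Qed.

(** For fixed [u] the map [F u] is a derivation into a module on which the ideal acts
by zero, so it vanishes on the ideal once it vanishes on the generators.  The
ideal has to be graded because the sign in the Leibniz rule depends on the degree
of the factor that lies in it. *)
Lemma bider_along_ideal (B C : gradedAlg K) (phi : B -> C) F (S : set B) :
  linear phi -> bider_along phi F ->
  (forall x, S x -> forall p, ideal_gen S (gcomp x p)) ->
  (forall x, ideal_gen S x -> phi x = 0) ->
  (forall u s, S s -> F u s = 0) ->
  forall u x, ideal_gen S x -> F u x = 0.
Proof.
move=> phil [[Fl Fr] FLr _] S_comp phi0 F0 u x Sx; move: u.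
have lin0 (V W : lmodType K) : linear (fun _ : V => 0 : W).
  by move=> k v w; rewrite scaler0 addr0.
elim: Sx => {x} [s Ss||x y _ IHx _ IHy|k x _ IHx|b x Sx IHx|
  b x Sx IHx] u.
- exact: F0.
- exact: linear_fun0.
- by rewrite linear_funD // IHx IHy addr0.
- by rewrite linear_funZ // IHx scaler0.
- move: u; apply: eq_linear_hom => // p u hu.
  move: b; apply: eq_linear_hom => // [|q b hb].
    exact: linear_comp (Fr u) (gmul_linearl x).
  have -> : F u (b \m x) =
      F u b \m phi x + sgnz ((p + n) * q) *: (phi b \m F u x).
    move: x {Sx IHx}; apply: eq_linear_hom => [||r c hc].
    + exact: linear_comp (Fr u) (gmul_linearr b).
    + apply: linear_add; first exact: linear_comp (gmul_linearr _) phil.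
      exact: linear_scale_fun (linear_comp (gmul_linearr _) (Fr u)).
    exact: FLr hu hb hc.
  by rewrite phi0 // IHx !gmul0r scaler0 addr0.
move: u; apply: eq_linear_hom => // p u hu.
move: b; apply: eq_linear_hom => // [|q b hb].
  exact: linear_comp (Fr u) (gmul_linearr x).
have [s [_ _ xE]] := comp_seq x.
transitivity (F u x \m phi b); last by rewrite IHx gmul0l.
rewrite {1 2}xE (linear_fun_sum _ _ _ (gmul_linearl b)) !(linear_fun_sum _ _ _ (Fr u)).
rewrite (linear_fun_sum _ _ _ (gmul_linearl _)); apply: eq_bigr => r _.
rewrite (FLr _ _ _ _ _ _ hu (comp_hom x r) hb).
by rewrite (phi0 _ (ideal_gen_comp S_comp r Sx)) gmul0l scaler0 addr0.
Qed.

End BiderivationsAlong.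

(** * The group action *)

Section GroupAction.
Variables (K : comPzRingType) (G : enrichedGroup).
Variables (A : gradedGAlg K G) (M : gCoalg K G).
Notation AM := (repAlg A M).
Implicit Types (g h : G) (a b : A) (al be : M).

Lemma gga_linear g : linear (@gga_act _ _ A g).
Proof. by case: (gga_iso A g). Qed.
Lemma gga_hom g p a : ga_hom p a -> ga_hom p (gga_act g a).
Proof. by case: (gga_iso A g) => _ _; apply. Qed.

Lemma gco_linear g : linear (@gco_act _ _ M g).
Proof.
by have [h|h] := pselect (eg_sub g); [case: (gco_aut M h)|case: (gco_antiaut M h)].
Qed.

Lemma gco_comul g be : eg_sub g ->
  co_mul M (gco_act g be) = tmap (gco_act g) (gco_act g) (co_mul M be).
Proof. by move=> /(gco_aut M)[_ _ ->]. Qed.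

Lemma gco_comul_anti g be : ~ eg_sub g ->
  co_mul M (gco_act g be) = tflip (tmap (gco_act g) (gco_act g) (co_mul M be)).
Proof. by move=> /(gco_antiaut M)[_ _ ->]; rewrite tflipK. Qed.

Let actgen g a al : AM := rgen (gga_act g a) (gco_act g al).

Let actgen_bilin g : bilin (actgen g).
Proof. exact: bilin_comp (rgen_bilinear A M) (gga_linear g) (gco_linear g). Qed.

(** Elements outside [eg_sub] reverse products both in [A] and in [M]; the two
reversals cancel in the commutative algebra [A_M], so the whole group acts on
it by automorphisms. *)
Lemma actgen_prod g a b al (s : seq (M * M)) :
  co_mul M al = \sum_(m <- s) m.1 \ox m.2 ->
  actgen g (a \m b) al = \sum_(m <- s) actgen g a m.1 \m actgen g b m.2.
Proof.
move=> sE; have gl := gco_linear g.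
have [gG|gG] := pselect (eg_sub g).
  have [_ gM] := gga_aut A gG; rewrite /actgen gM.
  rewrite (rgen_prod _ _ (s := [seq (gco_act g m.1, gco_act g m.2) | m <- s])).
    by rewrite big_map.
  rewrite big_map gco_comul // sE (linear_fun_sum _ _ _ (tmap_linear gl gl)).
  by apply: eq_bigr => m _; rewrite tmap_pure.
have [_ gM] := gga_antiaut A gG.
have agl c := (actgen_bilin g).1 c.
move: a; apply: eq_linear_hom => [||p a ha].
- exact: linear_comp (agl al) (gmul_linearl b).
- by apply: linear_sum => m; apply: linear_comp (gmul_linearl _) (agl _).
move: b; apply: eq_linear_hom => [||q b hb].
- exact: linear_comp (agl al) (gmul_linearr a).
- by apply: linear_sum => m; apply: linear_comp (gmul_linearr _) (agl _).
rewrite /actgen (gM _ _ _ _ ha hb).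
rewrite (linear_funZ _ _ ((rgen_bilinear A M).1 _)).
rewrite [X in _ *: X](rgen_prod _ _
  (s := [seq (gco_act g m.2, gco_act g m.1) | m <- s])).
  rewrite big_map scaler_sumr; apply: eq_bigr => m _ /=.
  exact/esym/(rep_gen0_comm _ _ (gga_hom g ha) (gga_hom g hb)).
rewrite big_map gco_comul_anti // sE (linear_fun_sum _ _ _ (tmap_linear gl gl)).
rewrite (linear_fun_sum _ _ _ (@tflip_linear _ _ _)).
by apply: eq_bigr => m _; rewrite tmap_pure // tflip_pure.
Qed.

Lemma actgen_comm g p q a b al be : ga_hom p a -> ga_hom q b ->
  actgen g a al \m actgen g b be = sgnz (p * q) *: (actgen g b be \m actgen g a al).
Proof. by move=> ha hb; apply: rep_gen0_comm; apply: gga_hom. Qed.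

Definition rep_act g : AM -> AM := rep_lift (@ga_mul K AM) (actgen g).

Lemma rep_act_gen g a al :
  rep_act g (rgen a al) = rgen (gga_act g a) (gco_act g al).
Proof.
exact: (rep_lift_gen (ga_mul_bilin AM) (@ga_mulA K AM) (actgen_bilin g)
  (@actgen_prod g) (@actgen_comm g)).
Qed.

Lemma rep_act_linear g : linear (rep_act g).
Proof.
exact: (rep_lift_linear (ga_mul_bilin AM) (@ga_mulA K AM) (actgen_bilin g)
  (@actgen_prod g) (@actgen_comm g)).
Qed.

Lemma rep_act_mul g x y : rep_act g (x \m y) = rep_act g x \m rep_act g y.
Proof.
exact: (rep_lift_mul (ga_mul_bilin AM) (@ga_mulA K AM) (actgen_bilin g)
  (@actgen_prod g) (@actgen_comm g)).
Qed.

Lemma rep_act_hom g p x : ga_hom p x -> ga_hom p (rep_act g x).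
Proof.
have gl := rep_act_linear g; move: p x.
apply: rep_homP => [p a al ha|p|p x y hx hy|p k x hx|p q x y _ _ hx hy].
- by rewrite rep_act_gen; apply/rgen_hom/gga_hom.
- by rewrite linear_fun0 //; apply: hom0.
- by rewrite linear_funD //; apply: homD.
- by rewrite linear_funZ //; apply: homZ.
by rewrite rep_act_mul; apply: ga_hom_mul.
Qed.

Lemma eq_alg_hom (C : gradedAlg K) (phi psi : AM -> C) :
  linear phi -> linear psi ->
  (forall x y, phi (x \m y) = phi x \m phi y) ->
  (forall x y, psi (x \m y) = psi x \m psi y) ->
  (forall a al, phi (rgen a al) = psi (rgen a al)) -> phi =1 psi.
Proof.
move=> fl gl fM gM fg; apply: rep_ind => [a al||x y IHx IHy|k x IHx|x y IHx IHy].
- exact: fg.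
- by rewrite (linear_fun0 fl) (linear_fun0 gl).
- by rewrite (linear_funD _ _ fl) (linear_funD _ _ gl) IHx IHy.
- by rewrite (linear_funZ _ _ fl) (linear_funZ _ _ gl) IHx.
by rewrite [LHS]fM [RHS]gM IHx IHy.
Qed.

Lemma rep_act_comp g h x : rep_act (g * h)%g x = rep_act g (rep_act h x).
Proof.
move: x; apply: eq_alg_hom => [|||x y|a al].
- exact: rep_act_linear.
- exact: linear_comp (rep_act_linear g) (rep_act_linear h).
- exact: rep_act_mul.
- by rewrite !rep_act_mul.
by rewrite !rep_act_gen (proj2 (gga_action A)) (proj2 (gco_action M)).
Qed.

Lemma rep_act1 x : rep_act 1%g x = x.
Proof.
move: x; apply: eq_alg_hom => [||||a al] //.
- exact: rep_act_linear.
- exact: rep_act_mul.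
by rewrite rep_act_gen (proj1 (gga_action A)) (proj1 (gco_action M)).
Qed.

Lemma rep_actK g : cancel (rep_act g) (rep_act g^-1%g).
Proof. by move=> x; rewrite -rep_act_comp mulVg rep_act1. Qed.

Lemma coinv_proj_linear : linear (@coinv_proj K G A M).
Proof. exact: quot_pi_linear. Qed.

Lemma coinv_proj_mul (x y : AM) :
  coinv_proj (x \m y) = coinv_proj x \m coinv_proj y.
Proof. exact: quot_pi_mul. Qed.

Lemma coinv_proj_hom p (x : AM) : ga_hom p x -> ga_hom p (coinv_proj x).
Proof. by exists x. Qed.

Lemma coinv_proj_act g (x : AM) : coinv_proj (rep_act g x) = coinv_proj x.
Proof.
move: x; apply: eq_alg_hom => [|||x y|a al].
- exact: linear_comp coinv_proj_linear (rep_act_linear g).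
- exact: coinv_proj_linear.
- by move=> x y; rewrite rep_act_mul coinv_proj_mul.
- exact: coinv_proj_mul.
rewrite rep_act_gen; apply/(quot_piP (@coinv_rel_comp K G A M))/ideal_gen_in.
by exists g, a, al.
Qed.

End GroupAction.

(** * Equivariance of the derived bracket *)

Section Equivariance.
Variables (K : comPzRingType) (G : enrichedGroup).
Variables (A : gradedGAlg K G) (M : gCoalg K G) (n : int).
Notation AM := (repAlg A M).
Variables (v : {scalar tens M M}) (v_equiv : equivariant_form v).
Implicit Types (g h : G) (a b : A) (al be : M).

Lemma contractr_act g al be : eg_sub g ->
  contractr v (gco_act g al) (gco_act g be) = gco_act g (contractr v al be).
Proof.
move=> gG; have gl := @gco_linear K G M g; rewrite /contractr gco_comul //.
have rb := contractr_bilinr v; rewrite (linear_tlift _ (rb al) gl).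
move: (co_mul M be); apply: tens_eq => [||mu nu].
- exact: linear_comp (tlift_linear (rb _)) (tmap_linear gl gl).
- exact: tlift_linear (bilin_post (rb al) gl).
rewrite tmap_pure // (tlift_pure (rb _)) (tlift_pure (bilin_post (rb al) gl)).
by rewrite v_equiv (linear_funZ _ _ gl).
Qed.

Lemma contractr_act_anti g al be : ~ eg_sub g ->
  contractr v (gco_act g al) (gco_act g be) = gco_act g (contractl v al be).
Proof.
move=> gG; have gl := @gco_linear K G M g; rewrite /contractr /contractl gco_comul_anti //.
have rb := contractr_bilinr v; have lb := contractl_bilinr v.
rewrite (linear_tlift _ (lb al) gl).
move: (co_mul M be); apply: tens_eq => [||mu nu].
- apply: linear_comp (tlift_linear (rb _)) _.
  exact: linear_comp (@tflip_linear _ _ _) (tmap_linear gl gl).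
- exact: tlift_linear (bilin_post (lb al) gl).
rewrite tmap_pure // tflip_pure (tlift_pure (rb _)).
by rewrite (tlift_pure (bilin_post (lb al) gl)) v_equiv (linear_funZ _ _ gl).
Qed.

Lemma contract_act g al be : eg_sub g ->
  contract v (gco_act g al) (gco_act g be) =
  tmap (gco_act g) (gco_act g) (contract v al be).
Proof.
move=> gG; have gl := @gco_linear K G M g; have idl := @linear_id_fun _ M.
have rl := contractr_linear v.
rewrite !contract_r gco_comul // !tmap_comp //.
by apply: eq_tmap => // m; apply: contractr_act.
Qed.

Lemma contract_act_anti g al be : ~ eg_sub g ->
  contract v (gco_act g al) (gco_act g be) =
  tflip (tmap (gco_act g) (gco_act g) (contract v al be)).
Proof.
move=> gG; have gl := @gco_linear K G M g; have idl := @linear_id_fun _ M.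
have rl := contractr_linear v; have ll := contractl_linear v.
rewrite contract_r contract_l gco_comul_anti // -tflip_tmap // !tmap_comp //.
by congr tflip; apply: eq_tmap => // m; apply: contractr_act_anti.
Qed.

Lemma rep_act_ev2 g x y :
  rep_act g (ev2 x y) =
  ev2 (tmap (gga_act g) (gga_act g) x) (tmap (gco_act g) (gco_act g) y) :> AM.
Proof.
have [l r] := ev2_bilin A M; have gl := @rep_act_linear K G A M g.
have al := @gga_linear K G A g; have ml := @gco_linear K G M g.
move: y; apply: tens_eq => [||mu nu].
- exact: linear_comp gl (r x).
- exact: linear_comp (r _) (tmap_linear ml ml).
move: x; apply: tens_eq => [||a b].
- exact: linear_comp gl (l _).
- exact: linear_comp (l _) (tmap_linear al al).
by rewrite !tmap_pure // !ev2_pure rep_act_mul !rep_act_gen.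
Qed.

Variables (db : {linear tens A A -> tens A A}) (br : AM -> AM -> AM).
Hypotheses (br_derived : derived_bracket n db v br).
Hypothesis db_equiv : equivariant_bracket db.

(** Both sides are biderivations along the automorphism [rep_act g].  On generators,
when [g] lies outside [eg_sub], it flips [db] as well as [contract], and
[ev2_flip] cancels the two flips. *)
Lemma derived_equiv g x y :
  br (rep_act g x) (rep_act g y) = rep_act g (br x y).
Proof.
move: x y; have [br_bider _] := br_derived.
have gl := @rep_act_linear K G A M g; have gM := @rep_act_mul _ _ A M g.
have gh := @rep_act_hom _ _ A M g.
apply: (bider_along_rgen (phi := rep_act g)
  (F := fun x y => br (rep_act g x) (rep_act g y))
  (F' := fun x y => rep_act g (br x y)) (n := n)).
- exact: bider_along_pre.
- exact: bider_along_post.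
move=> a b al be; rewrite !rep_act_gen !(derived_rgen br_derived) rep_act_ev2.
have [dbG dbNG] := db_equiv g a b; have [gG|gG] := pselect (eg_sub g).
  by rewrite dbG // contract_act.
by rewrite dbNG // contract_act_anti // ev2_flip.
Qed.

End Equivariance.

(** * The averaged bracket *)

Section AveragedBracket.
Variables (K : comPzRingType) (G : enrichedGroup).
Variables (A : gradedGAlg K G) (M : gCoalg K G) (n : int).
Notation AM := (repAlg A M).
Notation AMG := (coinvAlg A M).
Notation act := (@rep_act K G A M).
Notation q := (@coinv_proj K G A M).
Variable br : AM -> AM -> AM.
Hypothesis br_bider : biderivation n br.
Hypothesis br_equiv : forall g x y, br (act g x) (act g y) = act g (br x y).
Variable Gs : seq G.
Hypotheses (Gs_uniq : uniq Gs) (Gs_all : forall g, g \in Gs).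
Implicit Types (g h : G) (x y z : AM).

Lemma sum_bij (V : zmodType) (s t : G -> G) (f : G -> V) :
  cancel s t -> cancel t s -> \sum_(g <- Gs) f (s g) = \sum_(g <- Gs) f g.
Proof.
move=> st ts; rewrite -(big_map s xpredT f); apply: perm_big.
apply: uniq_perm => //; first by rewrite map_inj_uniq //; apply: can_inj st.
by move=> g; rewrite Gs_all -(ts g) map_f.
Qed.

Lemma sum_mull (V : zmodType) h (f : G -> V) :
  \sum_(g <- Gs) f (h * g)%g = \sum_(g <- Gs) f g.
Proof. by apply: sum_bij (mulKg h) (mulVKg h). Qed.

Lemma sum_inv (V : zmodType) (f : G -> V) :
  \sum_(g <- Gs) f g^-1%g = \sum_(g <- Gs) f g.
Proof. exact: sum_bij (@invgK _) (@invgK _). Qed.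

Lemma proj_br_act g h x y :
  q (br (act g x) (act h y)) = q (br (act (h^-1 * g)%g x) y).
Proof.
by rewrite -[act g x](rep_actK h^-1%g) invgK br_equiv coinv_proj_act rep_act_comp.
Qed.

Definition avg x y : AMG := \sum_(g <- Gs) q (br (act g x) y).

Lemma avg_along : bider_along n q avg.
Proof.
have ql := @coinv_proj_linear K G A M; have qM := @coinv_proj_mul K G A M.
have [bl br_] := bd_bilin br_bider.
have al g := @rep_act_linear K G A M g.
split.
- split=> [y|x]; apply: linear_sum => g.
    exact: linear_comp ql (linear_comp (bl y) (al g)).
  exact: linear_comp ql (br_ _).
- move=> i j k x y z hx hy hz; rewrite /avg.
  rewrite (linear_fun_sum _ _ _ (gmul_linearl _)) (linear_fun_sum _ _ _ (gmul_linearr _)).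
  rewrite scaler_sumr -big_split; apply: eq_bigr => g _ /=.
  rewrite (bd_leibnizr br_bider (rep_act_hom g hx) hy hz).
  by rewrite (linear_funD _ _ ql) (linear_funZ _ _ ql) !qM.
move=> i j k x y z hx hy hz; rewrite /avg.
rewrite (linear_fun_sum _ _ _ (gmul_linearr _)) (linear_fun_sum _ _ _ (gmul_linearl _)).
rewrite scaler_sumr -big_split; apply: eq_bigr => g _ /=.
rewrite rep_act_mul.
rewrite (bd_leibnizl br_bider (rep_act_hom g hx) (rep_act_hom g hy) hz).
by rewrite (linear_funD _ _ ql) (linear_funZ _ _ ql) !qM !coinv_proj_act.
Qed.

(** By invariance of [br], moving [g] to the first argument only permutes the terms
of the sum. *)
Lemma avg_actr g x y : avg x (act g y) = avg x y.
Proof.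
rewrite /avg -[RHS](sum_mull g^-1%g); apply: eq_bigr => h _.
exact: proj_br_act.
Qed.

Lemma avg_antisym i j x y : ga_hom i x -> ga_hom j y ->
  avg x y = - (sgnz ((i + n) * (j + n)) *: avg y x).
Proof.
have ql := @coinv_proj_linear K G A M; move=> hx hy.
rewrite /avg -[in RHS](sum_inv (fun g => q (br (act g y) x))).
rewrite scaler_sumr -sumrN; apply: eq_bigr => g _.
rewrite (bd_antisym br_bider (rep_act_hom g hx) hy).
rewrite (linear_funN _ ql) (linear_funZ _ _ ql); congr (- (_ *: _)).
by rewrite -{1}[y]rep_act1 proj_br_act mulg1.
Qed.

Lemma avg_idealr x y : ideal_gen (@coinv_rel K G A M) y -> avg x y = 0.
Proof.
have [[_ al] _ _] := avg_along.
apply: bider_along_ideal avg_along _ _ _ _ _ => //.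
- exact: coinv_proj_linear.
- exact: coinv_rel_comp.
- move=> z hz; rewrite -(linear_fun0 (@coinv_proj_linear K G A M)).
  by apply/(quot_piP (@coinv_rel_comp K G A M)); rewrite subr0.
move=> u _ [g [a [be ->]]].
rewrite (linear_funD _ _ (al u)) (linear_funN _ (al u)) -rep_act_gen avg_actr.
exact: subrr.
Qed.

(** Antisymmetry transfers [avg_idealr] to the first argument, one homogeneous
component at a time. *)
Lemma avg_ideall x y : ideal_gen (@coinv_rel K G A M) x -> avg x y = 0.
Proof.
move=> Ix; have [[al ar] _ _] := avg_along.
move: y; apply: eq_linear_hom => // [k u w|j y hy].
  by rewrite scaler0 addr0.
have [s [_ _ ->]] := comp_seq x.
rewrite (linear_fun_sum _ _ _ (al y)) big1 // => i _.
rewrite (avg_antisym (comp_hom x i) hy) avg_idealr ?scaler0 ?oppr0 //.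
exact: ideal_gen_comp (@coinv_rel_comp K G A M) _ _ Ix.
Qed.

Definition avg_bracket (X Y : AMG) : AMG := avg (quot_repr X) (quot_repr Y).

Lemma avg_bracketE x y : avg_bracket (q x) (q y) = avg x y.
Proof.
have [[al ar] _ _] := avg_along.
have qK z : ideal_gen (@coinv_rel K G A M) (quot_repr (q z) - z).
  apply/(quot_piP (@coinv_rel_comp K G A M)).
  exact: (qreprK (S := quot_setoid (@coinv_rel K G A M)) (q z)).
rewrite /avg_bracket; set x' := quot_repr (q x); set y' := quot_repr (q y).
apply/eqP; rewrite -subr_eq0 -(subrK (avg x y') (avg x' y')) -addrA.
rewrite -(linear_funN _ (al y')) -(linear_funD _ _ (al y')).
rewrite -(linear_funN _ (ar x)) -(linear_funD _ _ (ar x)).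
by apply/eqP; rewrite (avg_ideall _ (qK x)) (avg_idealr _ (qK y)) addr0.
Qed.

Lemma avg_bracket_bider : biderivation n avg_bracket.
Proof.
have [[al ar] Lr Ll] := avg_along; have ql := @coinv_proj_linear K G A M.
have surj := @quot_pi_surj _ _ _ (@coinv_rel_comp K G A M).
split.
- split=> [Y k X X'|X k Y Y'].
    have [[x <-] [x' <-] [y <-]] := And3 (surj X) (surj X') (surj Y).
    by rewrite -!/(q _) -ql !avg_bracketE al.
  have [[x <-] [y <-] [y' <-]] := And3 (surj X) (surj Y) (surj Y').
  by rewrite -!/(q _) -ql !avg_bracketE ar.
- move=> i j _ _ [x hx <-] [y hy <-]; rewrite -!/(q _) avg_bracketE.
  rewrite /avg; elim/big_rec: _ => [|g z _ hz]; first exact: hom0.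
  apply: homD => //; apply/coinv_proj_hom.
  exact: (bd_degree br_bider (rep_act_hom g hx) hy).
- move=> i j k _ _ _ [x hx <-] [y hy <-] [z hz <-]; rewrite -!/(q _).
  by rewrite -coinv_proj_mul !avg_bracketE (Lr _ _ _ _ _ _ hx hy hz).
- move=> i j k _ _ _ [x hx <-] [y hy <-] [z hz <-]; rewrite -!/(q _).
  by rewrite -coinv_proj_mul !avg_bracketE (Ll _ _ _ _ _ _ hx hy hz).
move=> i j _ _ [x hx <-] [y hy <-]; rewrite -!/(q _) !avg_bracketE.
exact: avg_antisym.
Qed.

Lemma avg_avg x y z : avg_bracket (q x) (avg_bracket (q y) (q z)) =
  \sum_(g <- Gs) \sum_(h <- Gs) q (br (act g x) (br (act h y) z)).
Proof.
have [[_ ar] _ _] := avg_along; have ql := @coinv_proj_linear K G A M.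
have [_ brr] := bd_bilin br_bider.
rewrite (avg_bracketE y z) /avg -(linear_fun_sum _ _ _ ql) avg_bracketE /avg.
apply: eq_bigr => g _; rewrite (linear_fun_sum _ _ _ (brr _)).
exact: linear_fun_sum ql.
Qed.

(** Invariance under a simultaneous translation of all three arguments rewrites each
of the three nested brackets as a sum over [g] and [h] of a bracket of
[act g x], [act h y] and [z]; the Jacobi identity then applies term by term. *)
Lemma avg_bracket_gerstenhaber : gerstenhaber n br -> gerstenhaber n avg_bracket.
Proof.
move=> [_ jac]; split; first exact: avg_bracket_bider.
have ql := @coinv_proj_linear K G A M.
move=> i j k _ _ _ [x hx <-] [y hy <-] [z hz <-]; rewrite -!/(q _) !avg_avg.
have move_act g u w t : q (br u (br w t)) =
    q (br (act g u) (br (act g w) (act g t))).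
  by rewrite !br_equiv coinv_proj_act.
have -> : \sum_(g <- Gs) \sum_(h <- Gs) q (br (act g y) (br (act h z) x)) =
    \sum_(g <- Gs) \sum_(h <- Gs) q (br (act h y) (br z (act g x))).
  rewrite exchange_big /= -[RHS]sum_inv; apply: eq_bigr => h _.
  rewrite -[RHS](sum_mull h^-1%g); apply: eq_bigr => g _.
  by rewrite (move_act h^-1%g) rep_actK -rep_act_comp.
have -> : \sum_(g <- Gs) \sum_(h <- Gs) q (br (act g z) (br (act h x) y)) =
    \sum_(g <- Gs) \sum_(h <- Gs) q (br z (br (act g x) (act h y))).
  rewrite [RHS]exchange_big /= -[RHS]sum_inv; apply: eq_bigr => g _.
  rewrite -[RHS](sum_mull g^-1%g); apply: eq_bigr => h _.
  by rewrite (move_act g^-1%g) rep_actK -rep_act_comp.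
have key g h : sgnz ((i + n) * (k + n)) *: q (br (act g x) (br (act h y) z)) +
    sgnz ((j + n) * (i + n)) *: q (br (act h y) (br z (act g x))) +
    sgnz ((k + n) * (j + n)) *: q (br z (br (act g x) (act h y))) = 0.
  have /(congr1 q) := jac _ _ _ _ _ _ (rep_act_hom g hx) (rep_act_hom h hy) hz.
  by rewrite (linear_fun0 ql) !(linear_funD _ _ ql) !(linear_funZ _ _ ql).
rewrite !scaler_sumr -!big_split; apply: big1 => g _.
by rewrite !scaler_sumr -!big_split; apply: big1 => h _; apply: key.
Qed.

End AveragedBracket.

Theorem lemma11p2 (K : comPzRingType) (G : enrichedGroup)
    (A : gradedGAlg K G) (M : gCoalg K G) (n : int)
    (db : {linear tens A A -> tens A A}) (v : {scalar tens M M})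
    (br : repAlg A M -> repAlg A M -> repAlg A M)
    (db_double : double_bracket n db)
    (db_equiv : equivariant_bracket db)
    (v_equiv : equivariant_form v)
    (v_cyclic : cyclic_form v)
    (br_derived : derived_bracket n db v br)
    (G_finite : finite_set [set: G]) :
  exists brG : coinvAlg A M -> coinvAlg A M -> coinvAlg A M,
    unique (fun brG' : coinvAlg A M -> coinvAlg A M -> coinvAlg A M =>
      biderivation n brG' /\
      forall (a b : A) (al be : M),
        brG' (coinv_proj (rgen a al)) (coinv_proj (rgen b be)) =
        \sum_(g \in [set: G])
          coinv_proj (br (rgen (gga_act g a) (gco_act g al)) (rgen b be))) brG /\
    (double_gerstenhaber n db -> gerstenhaber n brG).
Proof.
have [Gs [Gs_uniq Gs_all]] : exists s : seq G, uniq s /\ forall g, g \in s.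
  have /finite_seqP[s sE] := G_finite; exists (undup s).
  split=> [|g]; first exact: undup_uniq.
  by rewrite mem_undup; have : [set` s] g by rewrite -sE.
have sumE (V : zmodType) (f : G -> V) :
    \sum_(g \in [set: G]) f g = \sum_(g <- Gs) f g.
  rewrite [RHS]fsbig_seq //; suff -> : [set` Gs] = [set: G] by [].
  by apply/seteqP; split=> g //= _; apply: Gs_all.
have [br_bider _] := br_derived.
have br_equiv := derived_equiv v_equiv br_derived db_equiv.
have avgE := avg_bracketE br_bider br_equiv Gs_uniq Gs_all.
have avg_bider := avg_bracket_bider br_bider br_equiv Gs_uniq Gs_all.
exists (avg_bracket br Gs); split; last first.
  case=> _ db_jacobi; apply: avg_bracket_gerstenhaber => //.
  exact: derived_gerstenhaber br_derived db_double v_cyclic db_jacobi.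
split=> [|brG' [brG'_bider brG'E]].
  split=> // a b al be; rewrite avgE /avg sumE.
  by apply: eq_bigr => g _; rewrite rep_act_gen.
apply/funext => X; apply/funext => Y.
have [x <-] := quot_pi_surj X; have [y <-] := quot_pi_surj Y.
have along F : biderivation n F ->
    bider_along n (@coinv_proj K G A M) (fun x y => F (coinv_proj x) (coinv_proj y)).
  apply: bider_along_pre.
  - exact: coinv_proj_linear.
  - exact: coinv_proj_mul.
  - exact: coinv_proj_hom.
apply: (bider_along_rgen (along _ avg_bider) (along _ brG'_bider)) => a b al be.
rewrite brG'E avgE sumE /avg.
by apply: eq_bigr => g _; rewrite rep_act_gen.
Qed.
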